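(* Let $M$ be a ${\rm II}_1$-factor acting on $H=L^2(M,\tau)$, let $\{z_n\}_{n=1}^\infty\in\mathfrak S$, let $\phi=\sum_{n=1}^\infty \mathrm{Ad}\,Jz_nJ$, and let $P\subseteq M$ be the von Neumann algebra generated by $\{z_n\}_{n=1}^\infty$. (1) Let $\langle M,e_P\rangle\subseteq X\subseteq B(H)^\phi$ be an $\langle M,e_P\rangle$-$\langle M,e_P\rangle$ bimodule and let $\Phi:X\to B(H)^\phi$ be a unital normal linear map such that $\Phi(xTy)=x\Phi(T)y$ for all $x,y\in\langle M,e_P\rangle$ and $T\in X$. Then $\Phi$ is the identity on $X$. (2) Similarly, let $Pe_P=e_P\langle M,e_P\rangle e_P\subseteq X\subseteq e_PB(H)^\phi e_P$ be a $Pe_P$-$Pe_P$ bimodule and let $\Phi:X\to e_PB(H)^\phi e_P$ be a unital normal linear map (the unit being $e_P$) such that $\Phi(xTy)=x\Phi(T)y$ for all $x,y\in Pe_P$ and $T\in X$. Then $\Phi$ is the identity on $X$.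
   Context: $\tau$ is the unique tracial state of $M$, $\xi_0\in H=L^2(M,\tau)$ is the cyclic trace unit vector, and $J$ is the modular conjugation on $H$, $Jx\xi_0=x^*\xi_0$ for $x\in M$. For $a\in B(H)$, $\mathrm{Ad}\,a(T)=aTa^*$. Infinite sums are in the strong operator topology (pointwise for sums of maps). $\mathfrak S$ is the set of sequences $\{z_n\}_{n=1}^\infty$ in $M$ with $\sum_n z_nz_n^*=\sum_n z_n^*z_n=1$ such that for each $n$ there is $k$ with $z_n^*=z_k$. Then $\phi(T)=\sum_n Jz_nJ\,T\,Jz_n^*J$ is a unital normal completely positive map on $B(H)$, and $B(H)^\phi=\{T\in B(H):\phi(T)=T\}$. $e_P$ is the orthogonal projection of $H$ onto $L^2(P,\tau)$ (Jones projection), and $\langle M,e_P\rangle=(JPJ)'$ is the Jones basic extension; one has $P\subseteq M\subseteq\langle M,e_P\rangle\subseteq B(H)^\phi$. A bimodule here is a linear subspace of $B(H)$ closed under left and right multiplication (usual operator product) by the given algebra. Normal means continuous for the $\sigma$-weak topologies. *)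

(* Defs.v *)
From HB Require Import structures.
From mathcomp Require Import all_boot all_order all_algebra.
From mathcomp Require Import complex.
From mathcomp Require Import all_classical all_reals all_analysis.
Set Implicit Arguments.
Unset Strict Implicit.
Unset Printing Implicit Defensive.
Import Order.TTheory GRing.Theory Num.Theory Num.Def.
Import numFieldNormedType.Exports.
Local Open Scope classical_set_scope.
Local Open Scope ring_scope.

(* Naming the structure, and not only the carrier [R[i]], gives the complex
   numbers their norm topology through [numFieldNormedType]. *)
Definition Cplx (R : realType) : numClosedFieldType := R[i].

(* Operators on H are plain functions H -> H, the bounded ones being singled out
   by [bounded_op]; the product of operators is [\o]. *)
Section Operators.
Variables (R : realType) (H : completeNormedModType (Cplx R)).
Variable dot : {dot H for conjC}.
Implicit Types (S T A x y p v : H -> H) (M P X N : set (H -> H)) (E : set H).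

Definition hilbert := forall h : H, `|h| ^+ 2 = dot h h.

Definition bounded_op : set (H -> H) := [set T | linear T /\ continuous T].

(* The two choices below are determined whenever H is a Hilbert space and T is
   bounded, respectively E is a closed subspace. *)
Definition adjoint T : H -> H :=
  xget 0 [set S | forall h k, dot (T h) k = dot h (S k)].

Definition orth_proj E : H -> H :=
  fun h => xget 0 [set k | E k /\ forall l, E l -> dot (h - k) l = 0].

Definition commutant N : set (H -> H) :=
  [set T | bounded_op T /\ forall A, N A -> T \o A = A \o T].

Definition von_neumann_algebra M :=
  [/\ M `<=` bounded_op, forall x, M x -> M (adjoint x)
    & commutant (commutant M) = M].

Definition generated_vN N : set (H -> H) :=
  \bigcap_(M in [set M | von_neumann_algebra M /\ N `<=` M]) M.

Definition factor M :=
  von_neumann_algebra M /\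
  forall T, M T -> commutant M T -> exists a : Cplx R, T = a *: id.

Definition projection p := p \o p = p /\ adjoint p = p.

Definition finite_vN M :=
  forall v, M v -> adjoint v \o v = id -> v \o adjoint v = id.

Definition abelian_projection M p := projection p /\
  forall x y, M x -> M y ->
    (p \o x \o p) \o (p \o y \o p) = (p \o y \o p) \o (p \o x \o p).

Definition II1_factor M := [/\ factor M, finite_vN M
  & forall p, M p -> abelian_projection M p -> p = 0].

Definition tracial_state M (tau : (H -> H) -> Cplx R) :=
  [/\ forall (a : Cplx R) x y, M x -> M y ->
        tau (a *: x + y) = a * tau x + tau y,
      forall x, M x -> 0 <= tau (adjoint x \o x),
      tau id = 1
    & forall x y, M x -> M y -> tau (x \o y) = tau (y \o x)].

(* H is L^2(M, tau), with the class of x in M represented by x xi0; that xi0 is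
   a unit vector follows from tau 1 = 1. *)
Definition trace_representation M (tau : (H -> H) -> Cplx R) (xi0 : H) :=
  (forall x y, M x -> M y -> dot (x xi0) (y xi0) = tau (adjoint y \o x)) /\
  closure [set x xi0 | x in M] = setT.

Definition modular_conjugation M (xi0 : H) (J : H -> H) :=
  [/\ forall (a : Cplx R) h k, J (a *: h + k) = a^* *: J h + J k,
      forall h, `|J h| = `|h|
    & forall x, M x -> J (x xi0) = adjoint x xi0].

Definition strong_sum (F : nat -> H -> H) T :=
  forall h, series (fun n => F n h) @ \oo --> T h.

Definition frakS M (z : nat -> H -> H) :=
  [/\ forall n, M (z n),
      strong_sum (fun n => z n \o adjoint (z n)) id,
      strong_sum (fun n => adjoint (z n) \o z n) id
    & forall n, exists k, adjoint (z n) = z k].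

Definition Ad x T := x \o T \o adjoint x.

(* \sum_n Ad (J z_n J), summed pointwise; the series converges for every bounded
   T when z is in frakS M. *)
Definition Ad_sum (J : H -> H) (z : nat -> H -> H) T : H -> H :=
  fun h => limn (series (fun n => Ad (J \o z n \o J) T h)).

(* B(H)^phi *)
Definition harmonic_operators (phi : (H -> H) -> H -> H) : set (H -> H) :=
  [set T | bounded_op T /\ phi T = T].

Definition jones_projection (xi0 : H) P : H -> H :=
  orth_proj (closure [set x xi0 | x in P]).

(* The Jones basic extension <M, e_P> = (JPJ)' *)
Definition basic_extension (J : H -> H) P : set (H -> H) :=
  commutant [set J \o x \o J | x in P].

Definition corner p N : set (H -> H) := [set p \o T \o p | T in N].

Definition bimodule N X :=
  [/\ X `<=` bounded_op, X 0,
      forall (a : Cplx R) S T, X S -> X T -> X (a *: S + T)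
    & forall x T, N x -> X T -> X (x \o T) /\ X (T \o x)].

(* Maps defined on X are total functions of which only the values on X are
   constrained. *)
Definition linear_on X (Phi : (H -> H) -> H -> H) :=
  forall (a : Cplx R) S T, X S -> X T -> Phi (a *: S + T) = a *: Phi S + Phi T.

Definition bimodule_map N X (Phi : (H -> H) -> H -> H) :=
  forall x y T, N x -> N y -> X T -> Phi (x \o T \o y) = x \o Phi T \o y.

Definition square_summable (u : nat -> H) := cvgn (series (fun n => `|u n| ^+ 2)).

(* The sigma-weak topology is the initial topology for the functionals
   T |-> \sum_n <T xi_n, eta_n> with xi, eta square summable. *)
Definition square_summable_pairs : set ((nat -> H) * (nat -> H)) :=
  [set u | square_summable u.1 /\ square_summable u.2].

Definition sigma_weak_functional T (u : square_summable_pairs) : Cplx R :=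
  limn (series (fun n => dot (T ((val u).1 n)) ((val u).2 n))).

Definition sigma_weak : topologicalType := initial_topology
  (sigma_weak_functional : (H -> H) -> {ptws square_summable_pairs -> Cplx R}).

Definition normal_on X (Phi : (H -> H) -> H -> H) :=
  {within (X : set sigma_weak), continuous (Phi : sigma_weak -> sigma_weak)}.

End Operators.

(* Main.v *)
(** Idea. By bimodularity, it is enough to show that the vacuum expectation
    omega(T) = <T xi0, xi0> satisfies omega(Phi T) = omega(T) for T = e_P T e_P
    in X.  Put theta(S) = sum_n z_n^* S z_n.  Since J z_n^* J xi0 = z_n xi0,
    omega o theta = omega o phi, and theta commutes with phi; so harmonicity
    gives omega(theta^i T) = omega(T), while harmonicity of Phi(T) and
    bimodularity show that the normal functional kappa = omega o Phi satisfies
    kappa(theta^i T) = kappa(T).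
    Let t be a weak limit of theta^i(T) along an ultrafilter.  The operator T
    asymptotically commutes with J P J: with D_n = [T, J z_n^* J], the numbers
    sum_n omega(theta^i(D_n^* D_n)) are the increments of the nondecreasing
    bounded sequence omega(theta^i(T^* T)), hence tend to 0.  So t commutes with
    J P J, and t lies in e_P (JPJ)' e_P = P e_P, where Phi is the identity:
    omega(Phi T) = kappa(T) = kappa(t) = omega(t) = omega(T). *)

Require Import Defs.
From mathcomp Require Import all_boot all_order all_algebra.
From mathcomp Require Import complex.
From mathcomp Require Import all_classical all_reals all_analysis.
From mathcomp Require Import ring lra.
Import Order.TTheory GRing.Theory Num.Theory Num.Def.
Import numFieldNormedType.Exports.
Local Open Scope classical_set_scope.
Local Open Scope ring_scope.

Set Implicit Arguments.
Unset Strict Implicit.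
Unset Printing Implicit Defensive.

(** * Complex sequences and dominated series *)

Section ComplexConvergence.
Variable R : realType.
Local Notation K := (Cplx R).

(** [X] is an arbitrary linear bimodule, not assumed weakly closed: neither the infinite sum
    theta(T) nor a weak limit of its iterates is known beforehand to lie in it, so [Phi] cannot be
    applied to them. Normality is therefore used to extend S |-> <Phi(S) xi0, xi0> from [X] to a
    normal functional kappa on all bounded operators: near 0 it is controlled by finitely many
    sigma-weak functionals, so on [X] it is a linear combination of these. Vacuum values suffice in
    part (1) because <T a xi0, b xi0> = omega(e_P b^* T a e_P) and M xi0 is dense; in part (2) a and
    b range over P, with P xi0 dense in L^2(P). The compression also matches what the increments
    yield: decay at xi0 spreads along the z_n to L^2(P), and commutation of t with J P J there is
    enough once t = e_P t e_P. The equality e_P (JPJ)' e_P = P e_P rests on the estimate |a s xi0|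
    <= C |a xi0| for a in P', which makes s xi0 a bounded left multiplier. *)

Lemma Cplx_pos (e : K) : 0 < e -> e = (complex.Re e)%:C%C /\ 0 < complex.Re e.
Proof.
case: e => a b; rewrite (ltcE 0) /= => /andP[/eqP-> a0].
by rewrite complexr0.
Qed.

Lemma cvg_real_complex T (F : set_system T) {FF : Filter F} (u : T -> R) (l : R) :
  u @ F --> l -> (fun x => (u x)%:C%C : K) @ F --> (l%:C%C : K).
Proof.
move=> /cvgrPdist_lt ul; apply/cvgrPdist_lt => e /Cplx_pos[-> e0].
apply: filterS (ul _ e0) => x.
by rewrite -rmorphB /= normc_def /= expr0n addr0 sqrtr_sqr ltcR.
Qed.

Lemma Cplx_parts (z : K) : z = (complex.Re z)%:C%C + 'i%C * (complex.Im z)%:C%C.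
Proof. exact: complexE. Qed.

Lemma Cplx_ge0 (z : K) : 0 <= z -> z = (complex.Re z)%:C%C.
Proof. by case: z => a b; rewrite lecE /= => /andP[/eqP-> _]. Qed.

Lemma nondecreasing_Cplx_cvgn (u : nat -> K) (B : K) :
  (forall n, 0 <= u n) -> (forall n, u n <= u n.+1) -> (forall n, u n <= B) ->
  cvgn u.
Proof.
move=> u0 uS uB.
have leRe (a b : K) : a <= b -> complex.Re a <= complex.Re b.
  by rewrite lecE => /andP[].
have : cvgn (fun n => complex.Re (u n)).
  apply: nondecreasing_is_cvgn; first by apply/nondecreasing_seqP => n; exact/leRe.
  by exists (complex.Re B) => _ [n _ <-]; exact/leRe.
move=> /cvg_ex[l /cvg_real_complex ul]; apply/cvg_ex; exists (l%:C%C : K).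
by apply: cvg_trans ul; apply: near_eq_cvg; near=> n; rewrite -Cplx_ge0.
Unshelve. all: by end_near. Qed.

(** Real and imaginary parts stay in a compact segment, where every ultrafilter converges; the image
    of [U] under a map is again an ultrafilter. *)
Lemma bounded_ultra_cvg T (U : set_system T) (u : T -> K) (B : R) :
  UltraFilter U -> (\forall x \near U, `|u x| <= B%:C%C) ->
  exists l : K, u @ U --> l.
Proof.
move=> UU uB.
have imageU (f : T -> R) : UltraFilter (f @ U).
  split; first exact: fmap_proper_filter.
  move=> G PG fG; apply/seteqP; split => // A GA.
  have [//|UcA] := in_ultra_setVsetC (f @^-1` A) UU.
  have /(@filter_ex _ _ PG)[x []//] : G (A `&` ~` A) by apply: filterI => //; exact: fG.
have cv (f : T -> R) : (\forall x \near U, `|f x| <= B) -> exists l : R, f @ U --> l.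
  move=> fB; have := @segment_compact R (- B) B.
  rewrite compact_ultra => /(_ _ (imageU f))[|p [_ fp]]; last by exists p.
  by apply: filterS fB => x /=; rewrite in_itv /= ler_norml.
have [|a ua] := cv (fun x => complex.Re (u x)).
  by apply: filterS uB => x; move=> /(le_trans (normc_ge_Re _)); rewrite lecR.
have [|b ub] := cv (fun x => complex.Im (u x)).
  apply: filterS uB => x; rewrite normc_def lecR; apply: le_trans.
  by rewrite -sqrtr_sqr ler_wsqrtr // lerDr sqr_ge0.
exists ((a%:C + 'i * b%:C)%C : K).
have -> : u = fun x => (complex.Re (u x))%:C%C + 'i%C * (complex.Im (u x))%:C%C.
  by apply/funext => x; exact: Cplx_parts.
apply: cvgD; first exact: cvg_real_complex.
by apply: cvgMr; exact: cvg_real_complex.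
Qed.

End ComplexConvergence.

Section NumFieldConvergence.
Variable K : numFieldType.

(** The order of [K] is partial, so closedness of the positive cone is read off the norm: u = |u|
    forces l = |l|. *)
Lemma cvg_ge0 T (F : set_system T) {FF : ProperFilter F} (u : T -> K) (l : K) :
  u @ F --> l -> (forall x, 0 <= u x) -> 0 <= l.
Proof.
move=> ul u0; have nul : (fun x => `|u x|) @ F --> `|l| by exact: cvg_norm.
have E : (fun x => `|u x|) = u by apply/funext => x; rewrite ger0_norm.
rewrite E in nul.
by rewrite (cvg_unique _ ul nul).
Qed.

Lemma cvg_ler T (F : set_system T) {FF : ProperFilter F} (u v : T -> K) (l m : K) :
  u @ F --> l -> v @ F --> m -> (forall x, u x <= v x) -> l <= m.
Proof.
move=> ul vm uv; rewrite -subr_ge0.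
by apply: (@cvg_ge0 _ F _ (fun x => v x - u x)); [exact: cvgB | move=> x; rewrite subr_ge0].
Qed.

Lemma cvg0_le T (F : set_system T) {FF : Filter F} (V : normedModType K)
    (f : T -> V) (g : T -> K) :
  (forall x, `|f x| <= g x) -> g @ F --> (0 : K) -> f @ F --> (0 : V).
Proof.
move=> fg /cvgrPdist_lt g0; apply/cvgrPdist_lt => e /g0.
apply: filterS => x; rewrite !sub0r !normrN => h.
by apply: le_lt_trans h; rewrite ger0_norm //; exact: le_trans (fg x).
Qed.

Lemma cvg_of_dist_le T (F : set_system T) {FF : Filter F} (V : normedModType K)
    (f : T -> V) (l : V) (g : T -> K) :
  (forall x, `|f x - l| <= g x) -> g @ F --> (0 : K) -> f @ F --> l.
Proof.
move=> fg g0; apply/cvgrPdist_lt => e e0; move/cvgrPdist_lt: g0 => /(_ e e0).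
apply: filterS => x; rewrite sub0r normrN distrC => h.
by apply: le_lt_trans h; rewrite ger0_norm //; exact: le_trans (fg x).
Qed.

Lemma cvg_scaled_dist T (F : set_system T) {FF : Filter F} (V : normedModType K)
    (u : T -> V) (l : V) (C : K) :
  u @ F --> l -> (fun x => C * `|u x - l|) @ F --> (0 : K).
Proof.
move=> ul; have : (fun x => C * `|u x - l|) @ F --> C * `|l - l|.
  by apply: cvgMr; apply: cvg_norm; apply: cvgB => //; exact: cvg_cst.
by rewrite subrr normr0 mulr0.
Qed.

(** A single index close to both [l] and [m] suffices, at the price of doubling [e]; when [e] is 0
    there is no such room, but [f] is then eventually [m]. *)
Lemma cvg_dist_le T (F : set_system T) {FF : ProperFilter F} (V : normedModType K)
    (f : T -> V) (l m : V) (e : K) :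
  f @ F --> l -> (\forall x \near F, `|m - f x| <= e) -> `|m - l| <= e + e.
Proof.
move=> fl fm; have /cvgrPdist_le fle := fl.
have [x0 /= x0e] := filter_ex fm.
have e0 : 0 <= e by exact: le_trans x0e.
rewrite le_eqVlt in e0; case/orP: e0 => [/eqP e0|e0].
  rewrite -e0 addr0 normr_le0 subr_eq0; apply/eqP.
  suff fm' : f @ F --> m by exact: (cvg_unique _ fm' fl).
  apply/cvgrPdist_le => d d0; near=> x.
  have : `|m - f x| <= e by near: x.
  by rewrite -e0 => h; exact: le_trans h (ltW d0).
have [x [/= h1 h2]] := filter_ex (filterI (fle _ e0) fm).
rewrite -[m](subrK (f x)) -addrA.
by rewrite (le_trans (ler_normD _ _)) // lerD // distrC.
Unshelve. all: by end_near. Qed.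

Lemma cvg_series_at (V : normedModType K) T (F : set_system T) {FF : Filter F}
    (a : T -> nat -> V) (l : nat -> V) n :
  (forall i, (fun x => a x i) @ F --> l i) ->
  (fun x => series (a x) n) @ F --> series l n.
Proof.
move=> al; elim: n => [|n IH].
  rewrite /series /= big_geq //; under eq_fun do rewrite big_geq //.
  exact: cvg_cst.
rewrite seriesSr; under eq_fun do rewrite seriesSr.
exact: cvgD.
Qed.

Definition seq_complete (V : normedModType K) :=
  forall u : nat -> V, cauchy (u @ \oo) -> cvgn u.

Lemma series_dominated_cvg (V : normedModType K) (u : nat -> V) (b : nat -> K) :
  seq_complete V -> (forall n, `|u n| <= b n) -> cvgn (series b) -> cvgn (series u).
Proof.
move=> cV ub /cvg_cauchy/cauchy_seriesP bc; apply: cV; apply/cauchy_seriesP => e /bc.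
apply: filterS => -[m n] /= h; apply: le_lt_trans h.
apply: le_trans (ler_norm_sum _ _ _) _.
rewrite ger0_norm; first by apply: ler_sum.
by apply: sumr_ge0 => i _; exact: le_trans (ub i).
Qed.

Lemma complete_seq_complete (V : completeNormedModType K) : seq_complete V.
Proof. by move=> u /cauchy_cvgP. Qed.

(** Dominated convergence: the tails beyond N are controlled by the tail of [b], uniformly in [x],
    and a finite head converges termwise. *)
Lemma dominated_series (V : normedModType K) T (F : set_system T) {FF : ProperFilter F}
    (a : T -> nat -> V) (l : nat -> V) (b : nat -> K) :
  seq_complete V -> (forall x i, `|a x i| <= b i) -> cvgn (series b) ->
  (forall i, (fun x => a x i) @ F --> l i) ->
  (fun x => limn (series (a x))) @ F --> limn (series l).
Proof.
move=> cV ab cb al.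
have lb i : `|l i| <= b i.
  apply: (@cvg_ler _ F _ (fun x => `|a x i|) (fun=> b i)) => //.
    exact: cvg_norm (al i).
  exact: cvg_cst.
have cl : cvgn (series l) by exact: series_dominated_cvg lb cb.
have ca x : cvgn (series (a x)) by exact: series_dominated_cvg (ab x) cb.
have /cvg_cauchy/cauchy_seriesP cs := cb.
apply/cvgrPdist_le => e e0.
(* One fifth for the heads at N and two for each of the two tails, since [cvg_dist_le] doubles the
   Cauchy bound. *)
have e8 : 0 < e / 5 by rewrite divr_gt0.
have [[P Q] [/= [N1 _ P1] [N2 _ Q2]] PQ] := cs _ e8.
pose N := maxn N1 N2.
have tail (u : nat -> V) : (forall i, `|u i| <= b i) -> cvgn (series u) ->
    `|series u N - limn (series u)| <= e / 5 + e / 5.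
  move=> ub cu; apply: (cvg_dist_le cu); near=> n.
  have Nn : (N <= n)%N by near: n; exists N.
  rewrite distrC sub_series_geq //.
  have := PQ (N, n); rewrite /= => /(_ _)/ltW h; apply: le_trans (h _); last first.
    split; first by apply: P1; exact: leq_maxl.
    by apply: Q2; apply: leq_trans Nn; exact: leq_maxr.
  apply: le_trans (ler_norm_sum _ _ _) _.
  rewrite ger0_norm; first by apply: ler_sum.
  by apply: sumr_ge0 => i _; exact: le_trans (lb i).
have cN : (fun x => series (a x) N) @ F --> series l N.
  exact: cvg_series_at.
near=> x.
have h0 : `|series l N - series (a x) N| <= e / 5.
  by near: x; move/cvgrPdist_le: cN; apply.
have h1 := tail _ lb cl; have h2 := tail _ (ab x) (ca x).
have -> : limn (series l) - limn (series (a x)) =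
  (limn (series l) - series l N) + (series l N - series (a x) N)
   + (series (a x) N - limn (series (a x))).
  by rewrite -addrA subrKA subrKA.
rewrite (le_trans (ler_normD _ _)) //.
have -> : e = (e / 5 + e / 5 + e / 5) + (e / 5 + e / 5) by field.
by rewrite lerD // (le_trans (ler_normD _ _)) // lerD // distrC.
Unshelve. all: by end_near. Qed.

End NumFieldConvergence.

(** A Cauchy sequence is bounded, so it converges along an ultrafilter finer than \oo; the Cauchy
    condition carries the whole sequence to that limit. *)
Lemma Cplx_seq_complete (R : realType) : seq_complete (Cplx R).
Proof.
move=> u cu.
have [U [UU sU]] := ultraFilterLemma (eventually_filter : ProperFilter \oo).
have ce (e : Cplx R) : 0 < e ->
    exists N, forall m n, (N <= m)%N -> (N <= n)%N -> `|u m - u n| < e.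
  move=> e0; have /cauchy_ballP/(_ _ e0) := cu.
  case=> -[P Q] [/= [N1 _ P1] [N2 _ Q2]] PQ; exists (maxn N1 N2) => m n.
  rewrite !geq_max => /andP[m1 m2] /andP[n1 n2].
  have := PQ (u m, u n); rewrite -ball_normE /=; apply.
  by split; [exact: P1 | exact: Q2].
have [N HN] := ce 1 ltr01.
have [l ul] : exists l : Cplx R, u @ U --> l.
  have r1 : (1 + `|u N| : Cplx R) = (complex.Re (1 + `|u N|))%:C%C.
    by apply: Cplx_ge0; rewrite addr_ge0.
  apply: (@bounded_ultra_cvg _ _ _ _ (complex.Re (1 + `|u N|))) => //.
  apply: sU; exists N => // n /= Nn; rewrite -r1.
  rewrite -[u n](subrK (u N)) (le_trans (ler_normD _ _)) // lerD2r ltW //.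
  exact: HN.
apply/cvg_ex; exists l; apply/cvgrPdist_le => e e0.
have e2 : 0 < e / 2 by rewrite divr_gt0.
have [M HM] := ce _ e2; exists M => // n /= Mn.
rewrite distrC [leRHS](splitr e).
have UP : ProperFilter U := ultra_proper.
apply: (cvg_dist_le ul); apply: sU; exists M => // m /= Mm.
by rewrite ltW // HM.
Qed.

(** * Hilbert spaces *)

Section LinearMaps.
Variables (K : pzRingType) (U V : lmodType K) (T : U -> V).
Hypothesis linT : linear T.

Lemma lin0 : T 0 = 0.
Proof. by have := linT (-1) 0 0; rewrite scaler0 addr0 scaleN1r addNr. Qed.

Lemma linD h k : T (h + k) = T h + T k.
Proof. by rewrite -[h]scale1r linT !scale1r. Qed.

Lemma linZ a h : T (a *: h) = a *: T h.
Proof. by rewrite -[a *: h]addr0 linT lin0 addr0. Qed.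

Lemma linN h : T (- h) = - T h.
Proof. by rewrite -scaleN1r linZ scaleN1r. Qed.

Lemma linB h k : T (h - k) = T h - T k.
Proof. by rewrite linD linN. Qed.

End LinearMaps.

Lemma comp_at A B C D (f : B -> C) (g : A -> B) (f' : D -> C) (g' : A -> D) :
  f \o g = f' \o g' -> forall x, f (g x) = f' (g' x).
Proof. by move=> e x; rewrite -[LHS]/((f \o g) x) e. Qed.

Section InnerProduct.
Variables (R : realType) (H : completeNormedModType (Cplx R)).
Variable dot : {dot H for conjC}.
Hypothesis hdot : hilbert dot.
Local Notation K := (Cplx R).
Implicit Types (h k : H) (S : H -> H) (E : set H).

Lemma dotDl h h' k : dot (h + h') k = dot h k + dot h' k.
Proof. exact: linearDl. Qed.

Lemma dotDr h k k' : dot h (k + k') = dot h k + dot h k'.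
Proof. exact: linearDr. Qed.

Lemma dotBl h h' k : dot (h - h') k = dot h k - dot h' k.
Proof. exact: linearBl. Qed.

Lemma dotBr h k k' : dot h (k - k') = dot h k - dot h k'.
Proof. exact: linearBr. Qed.

Lemma dotNr h k : dot h (- k) = - dot h k.
Proof. exact: linearNr. Qed.

Lemma dotNl h k : dot (- h) k = - dot h k.
Proof. exact: linearNl. Qed.

Lemma dot0l k : dot 0 k = 0. Proof. exact: linear0l. Qed.

Lemma dot0r h : dot h 0 = 0. Proof. exact: linear0r. Qed.

Lemma dotZl a h k : dot (a *: h) k = a * dot h k.
Proof. exact: linearZl_LR. Qed.

Lemma dotZr a h k : dot h (a *: k) = a^* * dot h k.
Proof. exact: linearZr_LR. Qed.

Lemma dotC h k : dot h k = (dot k h)^*.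
Proof. by rewrite [LHS]hermC /= expr0 mul1r. Qed.

Lemma dot_suml I (r : seq I) (P : pred I) (F : I -> H) k :
  dot (\sum_(i <- r | P i) F i) k = \sum_(i <- r | P i) dot (F i) k.
Proof. by apply: (big_morph (dot^~ k)); [move=> a b; exact: dotDl | exact: dot0l]. Qed.

Lemma dot_ge0 h : 0 <= dot h h. Proof. exact: dnorm_ge0. Qed.

Lemma sqr_normD h k : `|h + k| ^+ 2 = `|h| ^+ 2 + `|k| ^+ 2 + (dot h k + (dot h k)^*).
Proof. by rewrite !hdot dnormD. Qed.

Lemma sqr_normB h k : `|h - k| ^+ 2 = `|h| ^+ 2 + `|k| ^+ 2 - (dot h k + (dot h k)^*).
Proof. by rewrite !hdot dnormB. Qed.

Lemma parallelogram h k :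
  `|h + k| ^+ 2 + `|h - k| ^+ 2 = 2 * `|h| ^+ 2 + 2 * `|k| ^+ 2.
Proof. by rewrite sqr_normD sqr_normB; ring. Qed.

(** Pythagoras for the component of [h] along [k]. Positivity of the left side is Cauchy-Schwarz;
    minimality of a distance turns the identity into orthogonality. *)
Lemma sqr_norm_proj h k : k != 0 ->
  `|h - (dot h k / `|k| ^+ 2) *: k| ^+ 2 = `|h| ^+ 2 - `|dot h k| ^+ 2 / `|k| ^+ 2.
Proof.
move=> k0; have nk : `|k| ^+ 2 != 0 by rewrite expf_neq0 // normr_eq0.
have qr : (`|k| ^+ 2)^* = `|k| ^+ 2 by rewrite conj_Creal // ger0_real ?exprn_ge0.
have qn : `| `|k| ^+ 2 | = `|k| ^+ 2 by rewrite ger0_norm ?exprn_ge0.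
rewrite sqr_normB dotZr normrZ normf_div exprMn exprMn exprVn qn.
rewrite !rmorphM /= !fmorphV /= !qr !conjCK normCK.
by field; rewrite normr_eq0.
Qed.

Lemma cauchy_schwarz h k : `|dot h k| <= `|h| * `|k|.
Proof.
have [->|k0] := eqVneq k 0; first by rewrite dot0r !normr0 mulr0.
rewrite -(@ler_pXn2r _ 2) ?nnegrE ?mulr_ge0 // exprMn.
have := exprn_ge0 2 (normr_ge0 (h - (dot h k / `|k| ^+ 2) *: k)).
by rewrite sqr_norm_proj // subr_ge0 ler_pdivrMr // exprn_gt0 // normr_gt0.
Qed.

Lemma dot_ext h : (forall k, dot h k = 0) -> h = 0.
Proof. by move=> /(_ h)/eqP; rewrite dnorm_eq0 => /eqP. Qed.

Lemma dot_inj h h' : (forall k, dot h k = dot h' k) -> h = h'.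
Proof. by move=> e; apply/eqP; rewrite -subr_eq0; apply/eqP/dot_ext => k; rewrite dotBl e subrr. Qed.

Lemma bounded_cvg (V : normedModType K) (f : H -> V) (C : K) I (F : set_system I)
    {FF : Filter F} (u : I -> H) h :
  (forall k k', f (k - k') = f k - f k') -> (forall k, `|f k| <= C * `|k|) ->
  u @ F --> h -> (fun x => f (u x)) @ F --> f h.
Proof.
move=> fB fC uh; apply: (@cvg_of_dist_le K _ _ _ V _ _ (fun x => C * `|u x - h|)).
  by move=> x; rewrite -fB fC.
exact: cvg_scaled_dist.
Qed.

Lemma cvg_dotl I (F : set_system I) {FF : Filter F} (u : I -> H) h k :
  u @ F --> h -> (fun x => dot (u x) k) @ F --> dot h k.
Proof.
apply: (@bounded_cvg K (dot^~ k) `|k|) => [a b|a]; first exact: dotBl.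
by rewrite mulrC cauchy_schwarz.
Qed.

Lemma cvg_dotr I (F : set_system I) {FF : Filter F} (u : I -> H) h k :
  u @ F --> k -> (fun x => dot h (u x)) @ F --> dot h k.
Proof.
apply: (@bounded_cvg K (dot h) `|h|) => [a b|a]; first exact: dotBr.
exact: cauchy_schwarz.
Qed.

Definition bounded_by (C : K) (T : H -> H) := forall h, `|T h| <= C * `|h|.

Lemma bounded_by_cvg C (T : H -> H) I (F : set_system I) {FF : Filter F} (u : I -> H) h :
  linear T -> bounded_by C T -> u @ F --> h -> (fun x => T (u x)) @ F --> T h.
Proof. by move=> lT; apply: bounded_cvg => k k'; exact: linB. Qed.

Lemma continuous_bound (V : normedModType K) (f : H -> V) :
  linear f -> continuous f -> exists2 C : K, 0 <= C & forall h, `|f h| <= C * `|h|.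
Proof.
move=> lf cf; have /cvgrPdist_lt/(_ 1 ltr01) := cf 0.
rewrite (lin0 lf) => /nbhs_ballP[d /= d0]; rewrite -ball_normE /= => fd.
exists (2 / d) => [|h]; first by rewrite divr_ge0 // ltW.
have [->|h0] := eqVneq h 0; first by rewrite (lin0 lf) !normr0 mulr0.
have nh : 0 < `|h| by rewrite normr_gt0.
have dr : `|d| = d by rewrite gtr0_norm.
have /fd : `|0 - (d / 2 / `|h|) *: h| < d.
  rewrite sub0r normrN normrZ !normrM normfV normfV normr_id (ger0_norm (ler0n _ 2)) dr.
  rewrite divfK ?normr_eq0 // ltr_pdivrMr // mulr_natr mulr2n ltrDl //.
rewrite sub0r normrN (linZ lf) normrZ !normrM normfV normfV normr_id (ger0_norm (ler0n _ 2)) dr.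
move=> /ltW h1.
have -> : `|f h| = 2 / d * `|h| * (d / 2 / `|h| * `|f h|).
  by field; rewrite normr_eq0 h0 lt0r_neq0.
by rewrite ler_piMr // mulr_ge0 // divr_ge0 // ltW.
Qed.

Lemma bounded_opP (T : H -> H) : bounded_op T <-> linear T /\ exists2 C : K, 0 <= C & bounded_by C T.
Proof.
split=> [[lT cT]|[lT [C C0 CT]]]; first by split=> //; exact: continuous_bound.
by split=> // h; apply: (bounded_by_cvg lT CT); exact: cvg_id.
Qed.

Lemma bounded_op_lin (T : H -> H) : bounded_op T -> linear T. Proof. by case. Qed.

Lemma bounded_op_cvg (T : H -> H) I (F : set_system I) {FF : Filter F} (u : I -> H) h :
  bounded_op T -> u @ F --> h -> (fun x => T (u x)) @ F --> T h.
Proof. by move=> /bounded_opP[lT [C _ CT]]; exact: (bounded_by_cvg lT CT). Qed.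

Lemma bounded_op_id : bounded_op (id : H -> H).
Proof. by split=> // h; exact: cvg_id. Qed.

Lemma bounded_op_comp S (T : H -> H) : bounded_op S -> bounded_op T -> bounded_op (S \o T).
Proof.
move=> [lS cS] [lT cT]; split=> [a h k|h]; first by rewrite /= lT lS.
by apply: continuous_comp; [exact: cT | exact: cS].
Qed.

Lemma bounded_op_lincomb (a : K) S (T : H -> H) :
  bounded_op S -> bounded_op T -> bounded_op (a *: S + T).
Proof.
move=> [lS cS] [lT cT]; split=> [b h k|h].
  by rewrite /= !fctE lS lT !scalerDr !scalerA [a * b]mulrC addrACA.
apply: cvgD; last exact: cT.
by apply: cvgZr; exact: cS.
Qed.

End InnerProduct.

(** * Closed subspaces, Riesz representation and adjoints *)

Section Projections.
Variables (R : realType) (H : completeNormedModType (Cplx R)).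
Variable dot : {dot H for conjC}.
Hypothesis hdot : hilbert dot.
Local Notation K := (Cplx R).
Implicit Types (h k l : H) (S T : H -> H) (E : set H).

Lemma closure_seq E h : closure E h -> exists2 u : nat -> H, (forall n, E (u n)) & u @ \oo --> h.
Proof.
move=> cE; have /choice[u uP] n : exists l, E l /\ `|h - l| < (harmonic n)%:C%C :> K.
  have h0 : 0 < (harmonic n)%:C%C :> K by rewrite ltcR invr_gt0.
  by have [l [El bl]] := cE _ (nbhsx_ballx h _ h0); exists l; move: bl; rewrite -ball_normE.
exists u => [n|]; first exact: (uP n).1.
apply: (@cvg_of_dist_le _ _ _ _ _ _ _ (fun n => (harmonic n)%:C%C)).
  by move=> n; rewrite distrC ltW // (uP n).2.
exact: (cvg_real_complex cvg_harmonic).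
Qed.

Lemma seq_closure E (u : nat -> H) h : (forall n, E (u n)) -> u @ \oo --> h -> closure E h.
Proof. by move=> Eu uh B /uh[N _ NB]; exists (u N); split=> //; apply: NB => /=. Qed.

Lemma seq_closed E : (forall (u : nat -> H) h, (forall n, E (u n)) -> u @ \oo --> h -> E h) -> closed E.
Proof. by move=> sE h /closure_seq[u Eu uh]; exact: sE uh. Qed.

Definition closed_subspace E :=
  [/\ closed E, E 0 & forall (a : K) h k, E h -> E k -> E (a *: h + k)].

Lemma subspaceB E h k : closed_subspace E -> E h -> E k -> E (h - k).
Proof. by case=> _ _ EL Eh Ek; rewrite addrC -scaleN1r; exact: EL. Qed.

Lemma subspaceZ E (a : K) h : closed_subspace E -> E h -> E (a *: h).
Proof. by case=> _ E0 EL Eh; rewrite -[_ *: _]addr0; exact: EL. Qed.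

(** Otherwise adding to [l] the component of h - l along [v] would lower the squared distance by |<h
    - l, v>|^2 / |v|^2. *)
Lemma nearest_orthogonal E h l : closed_subspace E -> E l ->
  (forall v, E v -> `|h - l| ^+ 2 <= `|h - v| ^+ 2) ->
  forall v, E v -> dot (h - l) v = 0.
Proof.
move=> sE El min v Ev; have [->|v0] := eqVneq v 0; first by rewrite dot0r.
pose a := dot (h - l) v / `|v| ^+ 2.
have Ew : E (a *: v + l) by case: sE => _ _; apply.
have := min _ Ew; rewrite opprD addrCA addrC sqr_norm_proj //.
rewrite lerBrDr gerDl => h1; apply/eqP; rewrite -normr_eq0 -sqrf_eq0 eq_le exprn_ge0 // andbT.
have vp : 0 < `|v| ^+ 2 by rewrite exprn_gt0 // normr_gt0.
by rewrite -(@pmulr_lle0 _ (`|v| ^- 2)) // invr_gt0.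
Qed.

Lemma projection_exists E h : closed_subspace E ->
  exists k, E k /\ forall l, E l -> dot (h - k) l = 0.
Proof.
move=> sE; have [cE E0 EL] := sE.
(* The norm takes values in [K]; its square is read as a real number so that an infimum is
   available. *)
pose N (x : H) : R := complex.Re (`|x| ^+ 2).
have NE x : `|x| ^+ 2 = (N x)%:C%C :> K by apply: Cplx_ge0; rewrite exprn_ge0.
have N0 x : 0 <= N x by rewrite -lecR -NE exprn_ge0.
pose A := [set N (h - l) | l in E].
have hA : has_inf A by split; [exists (N (h - 0)); exists 0 | exists 0 => _ [l _ <-]].
have dA v : E v -> inf A <= N (h - v) by move=> Ev; apply: ge_inf; [exact: hA.2 | exists v].
have /choice[u uP] n : exists l, E l /\ N (h - l) < inf A + n.+1%:R^-1.
  have [|_ [l El <-] lt] := @inf_adherent _ A (n.+1%:R^-1) _ hA; last by exists l.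
  by rewrite invr_gt0.
(* The midpoint of two points of [E] lies in [E], so the parallelogram law turns almost minimal
   distances into closeness. *)
have par m n : N (u m - u n) <= 2 * m.+1%:R^-1 + 2 * n.+1%:R^-1.
  have [Em m1] := uP m; have [En n1] := uP n.
  pose mid := (2^-1 : K) *: (u m + u n).
  have Emid : E mid by rewrite /mid scalerDr; apply: EL => //; exact: subspaceZ.
  have := parallelogram hdot (h - u m) (h - u n).
  have -> : h - u m - (h - u n) = - (u m - u n) by rewrite !opprB addrC addrA subrK.
  have -> : h - u m + (h - u n) = (2 : K) *: (h - mid).
    by rewrite scalerBr /mid scalerA divff ?pnatr_eq0 // scale1r scaler_nat mulr2n opprD addrACA.
  rewrite normrN normrZ exprMn (ger0_norm (ler0n _ 2)) !NE => e.
  have : 4 * N (h - mid) + N (u m - u n) = 2 * N (h - u m) + 2 * N (h - u n).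
    by apply: complexI; rewrite !rmorphD !rmorphM /= !rmorph_nat -e; congr (_ * _ + _); ring.
  move: (dA _ Emid) m1 n1; move: (inf A) (N (h - mid)) (N (u m - u n)) (N (h - u m)) (N (h - u n)).
  by move: (m.+1%:R^-1) (n.+1%:R^-1) => a b c d x y z *; lra.
have cu : cvgn u.
  apply: complete_seq_complete; apply/cauchy_ballP => e /Cplx_pos[-> e0].
  set e' := complex.Re e in e0 *.
  have e2 : 0 < e' ^+ 2 / 4 by rewrite divr_gt0 // exprn_gt0.
  have := @cvg_harmonic R; move=> /cvgrPdist_lt/(_ _ e2)[M _ HM].
  exists ([set u m | m in [set m | (M <= m)%N]], [set u m | m in [set m | (M <= m)%N]]).
    by split; exists M => // m Mm; exists m.
  move=> [_ _] [[/= m Mm <-] [n Mn <-]]; rewrite -ball_normE /=.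
  rewrite -(@ltr_pXn2r _ 2) ?nnegrE ?ler0c ?(ltW e0) // NE -rmorphXn ltcR.
  apply: le_lt_trans (par m n) _.
  have := HM _ Mm; have := HM _ Mn; rewrite /harmonic /= !sub0r !normrN !ger0_norm ?invr_ge0 //.
  by move: (m.+1%:R^-1) (n.+1%:R^-1) (e' ^+ 2) => a b c ? ?; lra.
pose l := limn u; have ul : u @ \oo --> l by [].
have El : E l by apply: (closed_cvg E cE _ l ul); near=> n; exact: (uP n).1.
exists l; split=> //; apply: nearest_orthogonal => // v Ev.
apply: (@cvg_ler _ _ \oo _ (fun n => `|h - u n| ^+ 2) (fun n => `|h - v| ^+ 2 + (harmonic n)%:C%C)).
- rewrite expr2; apply: cvgM; apply: cvg_norm; apply: cvgB => //; exact: cvg_cst.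
- rewrite -[X in _ --> X]addr0; apply: cvgD; first exact: cvg_cst.
  exact: (cvg_real_complex cvg_harmonic).
- move=> n; rewrite !NE -rmorphD lecR; have [_ /ltW/le_trans] := uP n; apply.
  by rewrite lerD2r dA.
Unshelve. all: by end_near. Qed.

(** The representing vector is a multiple of w = v - k, which is orthogonal to the closed kernel of
    [f]; the scalar comes from pairing w with f(v) h - f(h) w, an element of the kernel. *)
Lemma riesz (f : H -> K) (C : K) :
  (forall (a : K) h k, f (a *: h + k) = a * f h + f k) ->
  (forall h, `|f h| <= C * `|h|) -> exists k, forall h, f h = dot h k.
Proof.
move=> lf fC.
have f0 : f 0 = 0 by have := lf (-1) 0 0; rewrite scaler0 addr0 mulN1r addNr.
have fZ a h : f (a *: h) = a * f h by rewrite -[a *: h]addr0 lf f0 addr0.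
have fB h k : f (h - k) = f h - f k by rewrite addrC -scaleN1r lf mulN1r addrC.
have [[v v0]|h0] := pselect (exists v, f v != 0); last first.
  exists 0 => h; rewrite dot0r; apply: contrapT => fh; apply: h0; exists h; exact/eqP.
have sE : closed_subspace [set h | f h = 0].
  split=> [||a h k /= fh fk]; [| by [] | by rewrite lf fh fk mulr0 addr0].
  apply: seq_closed => u h /= fu uh.
  have fuh : f \o u @ \oo --> f h by exact: (@bounded_cvg _ _ K _ C _ _ _ u).
  have e0 : f \o u = cst 0 by apply/funext => n /=; exact: fu.
  by rewrite e0 in fuh; exact: (cvg_unique _ fuh (cvg_cst _)).
have [k [/= fk ok]] := projection_exists v sE.
have w0 : v - k != 0.
  by apply: contraNneq v0 => /(congr1 f); rewrite fB fk subr0 f0 => ->.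
have nw : dot (v - k) (v - k) != 0 by rewrite dnorm_eq0.
have fw : f (v - k) = f v by rewrite fB fk subr0.
move: (v - k) => w in ok w0 nw fw *.
exists (((f v)^* / dot w w) *: w) => h.
have : dot w (f v *: h - f h *: w) = 0.
  by apply: ok; rewrite fB !fZ fw mulrC subrr.
rewrite dotBr !dotZr => /subr0_eq e.
rewrite fmorph_div /= conjCK.
have e' : f v * dot h w = f h * dot w w.
  by apply: (can_inj (@conjCK _)); rewrite !rmorphM /= -!dotC.
by rewrite -dotC mulrAC e' mulfK.
Qed.

Lemma adjoint_exists T : bounded_op T -> exists S, forall h k, dot (T h) k = dot h (S k).
Proof.
move=> /bounded_opP[lT [C C0 TC]].
have /choice[S ST] k : exists s, forall h, dot (T h) k = dot h s.
  apply: (@riesz _ (C * `|k|)) => [a h h'|h]; first by rewrite lT dotDl dotZl.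
  by rewrite (le_trans (cauchy_schwarz hdot _ _)) // mulrAC ler_wpM2r.
by exists S => h k; exact: ST.
Qed.

Lemma adjointP T h k : bounded_op T -> dot (T h) k = dot h (adjoint dot T k).
Proof.
move=> bT; rewrite /adjoint; case: xgetP => [S _ ->//|nS].
by have [S ST] := adjoint_exists bT; case: (nS S).
Qed.

Lemma adjointPr T h k : bounded_op T -> dot h (T k) = dot (adjoint dot T h) k.
Proof. by move=> bT; rewrite dotC adjointP // -dotC. Qed.

Lemma adjoint_unique T S : bounded_op T -> (forall h k, dot (T h) k = dot h (S k)) -> adjoint dot T = S.
Proof.
move=> bT TS; apply/funext => k; apply: (@dot_inj _ _ dot) => h.
by rewrite dotC -adjointP // TS -dotC.
Qed.

Lemma bounded_by_adjoint T C : bounded_op T -> 0 <= C -> bounded_by C T -> bounded_by C (adjoint dot T).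
Proof.
move=> bT C0 TC h; have [->|n0] := eqVneq (adjoint dot T h) 0; first by rewrite normr0 mulr_ge0.
have n1 : 0 < `|adjoint dot T h| by rewrite normr_gt0.
rewrite -(ler_pM2r n1) -expr2 hdot -adjointP // -[dot _ _]ger0_norm; last first.
  by rewrite adjointP // dot_ge0.
rewrite (le_trans (cauchy_schwarz hdot _ _)) // mulrAC ler_wpM2r //; exact: TC.
Qed.

Lemma adjoint_linear T : bounded_op T -> linear (adjoint dot T).
Proof.
move=> bT a h k; apply: (@dot_inj _ _ dot) => l.
by rewrite dotDl dotZl -!adjointPr // dotDl dotZl.
Qed.

Lemma bounded_op_adjoint T : bounded_op T -> bounded_op (adjoint dot T).
Proof.
move=> bT; have /bounded_opP[lT [C C0 TC]] := bT.
apply/bounded_opP; split; first exact: adjoint_linear.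
by exists C => //; exact: bounded_by_adjoint.
Qed.

Lemma adjointK T : bounded_op T -> adjoint dot (adjoint dot T) = T.
Proof.
move=> bT; apply: adjoint_unique; first exact: bounded_op_adjoint.
by move=> h k; rewrite -adjointPr.
Qed.

Lemma adjoint_comp S T : bounded_op S -> bounded_op T ->
  adjoint dot (S \o T) = adjoint dot T \o adjoint dot S.
Proof.
move=> bS bT; apply: adjoint_unique; first exact: bounded_op_comp.
by move=> h k /=; rewrite !adjointP.
Qed.

Lemma adjoint_id : adjoint dot id = id.
Proof. by apply: adjoint_unique => //; exact: bounded_op_id. Qed.

Section OrthogonalProjection.
Variable E : set H.
Hypothesis sE : closed_subspace E.
Local Notation p := (orth_proj dot E).

Lemma orth_projP h : E (p h) /\ forall l, E l -> dot (h - p h) l = 0.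
Proof.
rewrite /orth_proj; case: xgetP => [k _ //|nk].
by have [k kP] := projection_exists h sE; case: (nk k).
Qed.

Lemma orth_proj_in h : E (p h). Proof. exact: (orth_projP h).1. Qed.

Lemma dot_orth_proj h l : E l -> dot (p h) l = dot h l.
Proof. by move=> /(orth_projP h).2; rewrite dotBl => /subr0_eq. Qed.

Lemma dot_orth_projr h l : E l -> dot l (p h) = dot l h.
Proof. by move=> El; rewrite dotC dot_orth_proj // -dotC. Qed.

Lemma orth_proj_fix h : E h -> p h = h.
Proof.
move=> Eh; apply/eqP; rewrite eq_sym -subr_eq0 -(dnorm_eq0 dot) (orth_projP h).2 //.
by apply: subspaceB => //; exact: orth_proj_in.
Qed.

Lemma orth_proj_sym h k : dot (p h) k = dot h (p k).
Proof. by rewrite -[RHS]dot_orth_proj ?dot_orth_projr //; exact: orth_proj_in. Qed.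

Lemma orth_proj_linear : linear p.
Proof.
move=> a h k; apply: (@dot_inj _ _ dot) => l.
by rewrite dotDl dotZl !orth_proj_sym dotDl dotZl.
Qed.

Lemma orth_proj_le : bounded_by 1 p.
Proof.
move=> h; rewrite mul1r; have [->|n0] := eqVneq (p h) 0; first by rewrite normr0.
have n1 : 0 < `|p h| by rewrite normr_gt0.
rewrite -(ler_pM2r n1) -expr2 hdot -[dot _ _]ger0_norm ?dot_ge0 //.
by rewrite dot_orth_proj ?cauchy_schwarz //; exact: orth_proj_in.
Qed.

Lemma bounded_op_orth_proj : bounded_op p.
Proof.
apply/bounded_opP; split; first exact: orth_proj_linear.
by exists 1 => //; exact: orth_proj_le.
Qed.

Lemma adjoint_orth_proj : adjoint dot p = p.
Proof. by apply: adjoint_unique; [exact: bounded_op_orth_proj | exact: orth_proj_sym]. Qed.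

Lemma orth_proj_idem : p \o p = p.
Proof. by apply/funext => h /=; rewrite orth_proj_fix //; exact: orth_proj_in. Qed.

Lemma orth_proj_commutes T : bounded_op T -> (forall h, E h -> E (T h)) ->
  (forall h, E h -> E (adjoint dot T h)) -> p \o T = T \o p.
Proof.
move=> bT ET ET'; apply/funext => h /=; apply: (@dot_inj _ _ dot) => k.
rewrite orth_proj_sym adjointP // -dot_orth_proj; last by apply: ET'; exact: orth_proj_in.
by rewrite -adjointP // dot_orth_projr //; apply: ET; exact: orth_proj_in.
Qed.

End OrthogonalProjection.

End Projections.

Lemma series_le_lim (K : numFieldType) (b : nat -> K) l m n :
  (forall k, 0 <= b k) -> series b @ \oo --> l -> \sum_(m <= k < n) b k <= l.
Proof.
move=> b0 bl; apply: (@le_trans _ _ (series b n)).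
  have [mn|/ltnW nm] := leqP m n; last by rewrite big_geq // sumr_ge0.
  by rewrite -(sub_series_geq b mn) gerBl sumr_ge0.
have leb j : series b n <= series b (n + j)%N by rewrite addnC series_addn lerDl sumr_ge0.
apply: (@cvg_ler _ _ \oo _ (fun=> series b n) (fun j => series b (n + j)%N)).
- exact: cvg_cst.
- have -> : (fun j => series b (n + j)%N) = fun j => series b (j + n)%N.
    by apply/funext => j; rewrite addnC.
  by rewrite (@cvg_shiftn n _ (series b)).
- exact: leb.
Qed.

Lemma mul2_le_sqrD (K : numDomainType) (x y : K) : 0 <= x -> 0 <= y ->
  2 * (x * y) <= x ^+ 2 + y ^+ 2.
Proof.
move=> x0 y0; rewrite -subr_ge0.
have -> : x ^+ 2 + y ^+ 2 - 2 * (x * y) = (x - y) ^+ 2 by ring.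
by rewrite real_exprn_even_ge0 // realB // ger0_real.
Qed.

Lemma cvg_conjC (R : realType) I (F : set_system I) {FF : Filter F} (u : I -> Cplx R) l :
  u @ F --> l -> (fun i => (u i)^*) @ F --> l^*.
Proof.
move=> ul; apply: (@cvg_of_dist_le _ _ _ _ _ _ _ (fun i => 1 * `|u i - l|)).
  by move=> i; rewrite mul1r -rmorphB norm_conjC.
exact: cvg_scaled_dist.
Qed.

(** * Completely positive maps given by columns *)

Section ColumnMaps.
Variables (R : realType) (H : completeNormedModType (Cplx R)).
Variable dot : {dot H for conjC}.
Hypothesis hdot : hilbert dot.
Local Notation K := (Cplx R).
Local Notation "T ^*" := (adjoint dot T) : ring_scope.
Implicit Types (h k l : H) (S T : H -> H).

(* The column (a_0, a_1, ...) is an isometry of H into l^2(H), and [column_map a S]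
   is the compression to H of S acting diagonally on l^2(H). *)
Definition column_isometry (a : nat -> H -> H) :=
  (forall n, bounded_op (a n)) /\
  strong_sum (fun n => adjoint dot (a n) \o a n) id.

Definition column_map (a : nat -> H -> H) S : H -> H :=
  fun h => limn (series (fun n => (a n)^* (S (a n h)))).

Variable a : nat -> H -> H.
Hypothesis aP : column_isometry a.
Local Notation theta := (column_map a).

Lemma column_isometry_norm h : series (fun n => `|a n h| ^+ 2) @ \oo --> (`|h| ^+ 2 : K).
Proof.
have [ba /(_ h) ah] := aP.
rewrite (_ : series _ = fun n => dot (series (fun n => (a n)^* (a n h)) n) h).
  by rewrite hdot; exact: cvg_dotl.
apply/funext => n; rewrite /series /= dot_suml; apply: eq_bigr => i _.
by rewrite -adjointPr // hdot.
Qed.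

(** The adjoint of a column isometry is a contraction from l^2(H) to [H]. For the sum [w] one has
    |w|^2 = sum <v_k, a_k w>; then 2 x y <= x^2 + y^2 and sum |a_k w|^2 <= |w|^2 give the bound. *)
Lemma column_sum_le (v : nat -> H) m n :
  `|\sum_(m <= k < n) (a k)^* (v k)| ^+ 2 <= \sum_(m <= k < n) `|v k| ^+ 2.
Proof.
set w := \sum_(m <= k < n) _.
have ba := aP.1; have aw := column_isometry_norm.
have e1 : `|w| ^+ 2 = \sum_(m <= k < n) dot (v k) (a k w).
  by rewrite hdot {1}/w dot_suml; apply: eq_bigr => k _; rewrite adjointPr.
have : 2 * `|w| ^+ 2 <= \sum_(m <= k < n) `|v k| ^+ 2 + \sum_(m <= k < n) `|a k w| ^+ 2.
  rewrite -[X in 2 * X]ger0_norm ?exprn_ge0 // e1 -big_split /=.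
  apply: le_trans (_ : 2 * (\sum_(m <= k < n) `|v k| * `|a k w|) <= _).
    rewrite ler_pM2l //; apply: le_trans (ler_norm_sum _ _ _) _.
    by apply: ler_sum => k _; exact: cauchy_schwarz.
  by rewrite mulr_sumr; apply: ler_sum => k _; exact: mul2_le_sqrD.
have h1 : \sum_(m <= k < n) `|a k w| ^+ 2 <= `|w| ^+ 2.
  by apply: series_le_lim (aw w) => k; rewrite exprn_ge0.
rewrite mulr_natl mulr2n => h2.
by rewrite -(lerD2r (`|w| ^+ 2)); apply: le_trans h2 _; rewrite lerD2l.
Qed.

Lemma column_cvg (v : nat -> H) : cvgn (series (fun n => `|v n| ^+ 2 : K)) ->
  cvgn (series (fun n => (a n)^* (v n))).
Proof.
move=> /cvg_cauchy/cauchy_seriesP cv.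
apply: complete_seq_complete; apply/cauchy_seriesP => e e0.
apply: filterS (cv _ (exprn_gt0 2 e0)) => -[m n] /= lt.
rewrite -(@ltr_pXn2r _ 2) ?nnegrE ?(ltW e0) //.
apply: le_lt_trans (column_sum_le _ _ _) _; apply: le_lt_trans lt.
by rewrite ger0_norm // sumr_ge0 // => k _; rewrite exprn_ge0.
Qed.

Lemma column_lim_le (v : nat -> H) (l : K) : series (fun n => `|v n| ^+ 2) @ \oo --> l ->
  `|limn (series (fun n => (a n)^* (v n)))| ^+ 2 <= l.
Proof.
move=> vl; have cv : cvgn (series (fun n => (a n)^* (v n))).
  by apply: column_cvg; apply/cvg_ex; exists l.
apply: (@cvg_ler _ _ \oo _ (fun n => `|series (fun n => (a n)^* (v n)) n| ^+ 2) _ _ _ _ vl).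
  by rewrite expr2; apply: cvgM; apply: cvg_norm.
by move=> n; exact: column_sum_le.
Qed.

Lemma bounded_by_sqr C S h : 0 <= C -> bounded_by C S -> `|S h| ^+ 2 <= C ^+ 2 * `|h| ^+ 2.
Proof. by move=> C0 SC; rewrite -exprMn ler_pXn2r ?nnegrE ?mulr_ge0. Qed.

(** [bounded_by] puts no condition on [C] beyond the inequality itself, and on a zero space any [C]
    qualifies; |C| restores nonnegativity. *)
Lemma bounded_by_ge0 C S : bounded_by C S -> bounded_by `|C| S.
Proof.
move=> SC h; apply: le_trans (SC h) _.
by rewrite -[leLHS](ger0_norm (le_trans (normr_ge0 _) (SC h))) normrM normr_id.
Qed.

Lemma column_isometry_scaled (C : K) h :
  series (fun n => C * `|a n h| ^+ 2) @ \oo --> C * `|h| ^+ 2.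
Proof.
have -> : series (fun n => C * `|a n h| ^+ 2) = fun n => C * series (fun n => `|a n h| ^+ 2) n.
  by apply/funext => n; rewrite /series /= mulr_sumr.
by apply: cvgMr; exact: column_isometry_norm.
Qed.

Lemma column_sqr_cvg S h : bounded_op S -> cvgn (series (fun n => `|S (a n h)| ^+ 2 : K)).
Proof.
move=> /bounded_opP[lS [C C0 SC]].
apply: (@series_dominated_cvg _ K _ (fun n => C ^+ 2 * `|a n h| ^+ 2)).
- exact: Cplx_seq_complete.
- by move=> n; rewrite ger0_norm ?exprn_ge0 // bounded_by_sqr.
- by apply/cvg_ex; exists (C ^+ 2 * `|h| ^+ 2); exact: column_isometry_scaled.
Qed.

Lemma column_map_cvg S h : bounded_op S ->
  series (fun n => (a n)^* (S (a n h))) @ \oo --> theta S h.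
Proof. by move=> bS; apply: column_cvg; exact: column_sqr_cvg. Qed.

Lemma column_map_dot S h k : bounded_op S ->
  series (fun n => dot (S (a n h)) (a n k)) @ \oo --> dot (theta S h) k.
Proof.
move=> bS; rewrite (_ : series _ = fun n => dot (series (fun n => (a n)^* (S (a n h))) n) k).
  by apply: cvg_dotl => //; exact: column_map_cvg.
apply/funext => n; rewrite /series /= dot_suml; apply: eq_bigr => i _.
by rewrite -adjointPr //; exact: aP.1.
Qed.

Lemma column_map_le S h (l : K) :
  series (fun n => `|S (a n h)| ^+ 2) @ \oo --> l -> `|theta S h| ^+ 2 <= l.
Proof. exact: column_lim_le. Qed.

Lemma column_map_linear S : bounded_op S -> linear (theta S).
Proof.
move=> bS b h k; apply: (@dot_inj _ _ dot) => l.
have e : series (fun n => dot (S (a n (b *: h + k))) (a n l)) =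
    (fun n => b * series (fun n => dot (S (a n h)) (a n l)) n
     + series (fun n => dot (S (a n k)) (a n l)) n).
  apply/funext => n; rewrite /series /= mulr_sumr -big_split /=; apply: eq_bigr => i _.
  by rewrite (bounded_op_lin (aP.1 i)) (bounded_op_lin bS) dotDl dotZl.
have c2 : series (fun n => dot (S (a n (b *: h + k))) (a n l)) @ \oo -->
    dot (b *: theta S h + theta S k) l.
  rewrite e dotDl dotZl; apply: cvgD; last exact: column_map_dot.
  by apply: cvgMr; exact: column_map_dot.
exact: (cvg_unique _ (column_map_dot bS) c2).
Qed.

Lemma column_map_bounded C S : linear S -> bounded_by C S -> bounded_by C (theta S).
Proof.
move=> lS SC.
have SC' := bounded_by_ge0 SC.
have bS : bounded_op S by apply/bounded_opP; split=> //; exists `|C|.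
move=> h; have C0 : 0 <= C * `|h| by exact: le_trans (SC h).
rewrite -(@ler_pXn2r _ 2) ?nnegrE //.
have /cvg_ex[l Sl] := @column_sqr_cvg _ h bS.
apply: le_trans (column_map_le Sl) _; rewrite exprMn.
have -> : C ^+ 2 * `|h| ^+ 2 = `|C| ^+ 2 * `|h| ^+ 2.
  by rewrite -!exprMn -[in LHS](ger0_norm C0) normrM normr_id.
apply: (cvg_ler Sl (@column_isometry_scaled (`|C| ^+ 2) h)) => n.
by rewrite /series /=; apply: ler_sum => i _; rewrite bounded_by_sqr.
Qed.

Lemma bounded_op_column_map S : bounded_op S -> bounded_op (theta S).
Proof.
move=> bS; have /bounded_opP[lS [C C0 SC]] := bS.
apply/bounded_opP; split; first exact: column_map_linear.
by exists C => //; exact: column_map_bounded.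
Qed.

(** An operator is identified by its matrix coefficients, and those of theta(S) are sums of <S a_n
    h, a_n k>; the algebraic rules that follow are checked term by term. *)
Lemma column_map_unique S T : bounded_op S ->
  (forall h k, series (fun n => dot (S (a n h)) (a n k)) @ \oo --> dot (T h) k) -> theta S = T.
Proof.
move=> bS ST; apply/funext => h; apply: (@dot_inj _ _ dot) => k.
exact: (cvg_unique _ (column_map_dot bS) (ST h k)).
Qed.

Lemma column_map_lincomb (b : K) S T : bounded_op S -> bounded_op T ->
  theta (b *: S + T) = b *: theta S + theta T.
Proof.
move=> bS bT; apply: column_map_unique; first exact: bounded_op_lincomb.
move=> h k; rewrite !fctE dotDl dotZl.
rewrite (_ : series _ = (fun n => b * series (fun n => dot (S (a n h)) (a n k)) n
   + series (fun n => dot (T (a n h)) (a n k)) n)).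
  apply: cvgD; last exact: column_map_dot.
  by apply: cvgMr; exact: column_map_dot.
apply/funext => n; rewrite /series /= mulr_sumr -big_split /=; apply: eq_bigr => i _.
by rewrite dotDl dotZl.
Qed.

Lemma column_map_adjoint S : bounded_op S -> theta (S^*) = (theta S)^*.
Proof.
move=> bS; apply: column_map_unique; first exact: bounded_op_adjoint.
move=> h k; rewrite -adjointPr //; last exact: bounded_op_column_map.
rewrite dotC (_ : series _ = fun n => conjC (series (fun n => dot (S (a n k)) (a n h)) n)).
  by apply: cvg_conjC; exact: column_map_dot.
apply/funext => n; rewrite /series /= rmorph_sum /=; apply: eq_bigr => i _.
by rewrite -dotC -adjointPr.
Qed.

(** The condition is put on T^* because [T] is moved onto the second vector: <T S a_n h, a_n k> = <S
    a_n h, a_n T^* k>. *)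
Lemma column_map_mull S T : bounded_op S -> bounded_op T ->
  (forall n, T^* \o a n = a n \o T^* ) -> theta (T \o S) = T \o theta S.
Proof.
move=> bS bT Ta; apply: column_map_unique; first exact: bounded_op_comp.
move=> h k /=; rewrite adjointP //.
rewrite (_ : (fun n => _) = fun n => dot (S (a n h)) (a n (T^* k))).
  exact: column_map_dot.
by apply/funext => n; rewrite adjointP // (comp_at (Ta n) k).
Qed.

Lemma column_map_mulr S T : bounded_op S -> bounded_op T ->
  (forall n, T \o a n = a n \o T) -> theta (S \o T) = theta S \o T.
Proof.
move=> bS bT Ta; apply: column_map_unique; first exact: bounded_op_comp.
move=> h k /=.
rewrite (_ : (fun n => _) = fun n => dot (S (a n (T h))) (a n k)).
  exact: column_map_dot.
by apply/funext => n; rewrite (comp_at (Ta n) h).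
Qed.

Lemma column_map_pos S : bounded_op S -> (forall h, 0 <= dot (S h) h) ->
  forall h, 0 <= dot (theta S h) h.
Proof.
move=> bS S0 h; apply: (cvg_ge0 (@column_map_dot _ h h bS)) => n.
by rewrite /series /= sumr_ge0.
Qed.

Lemma column_map_term_le S : bounded_op S -> (forall h, 0 <= dot (S h) h) ->
  forall n h, dot (S (a n h)) (a n h) <= dot (theta S h) h.
Proof.
move=> bS S0 n h; have := @series_le_lim _ _ _ n n.+1 _ (@column_map_dot _ h h bS).
by rewrite big_nat1; apply.
Qed.

(** Kadison-Schwarz inequality: with theta(S) = V^* S V, where V is the column isometry and S acts
    diagonally, |V^* S V h| <= |S V h|. *)
Lemma column_map_schwarz S h : bounded_op S ->
  `|theta S h| ^+ 2 <= dot (theta (S^* \o S) h) h.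
Proof.
move=> bS; apply: column_map_le.
have bSS : bounded_op (S^* \o S) by apply: bounded_op_comp => //; exact: bounded_op_adjoint.
have := @column_map_dot _ h h bSS; rewrite (_ : (fun n => dot _ _) = (fun n => `|S (a n h)| ^+ 2)) //.
by apply/funext => n /=; rewrite -adjointPr // hdot.
Qed.

End ColumnMaps.

(** Convergence in the product topology is tested on coordinates; surjectivity of each projection,
    needed to pass to images, comes from altering [g] at one index. *)
Lemma filter_cvg_ptws (I : choiceType) (V : uniformType) T (f : T -> I -> V) (F : set_system T)
    {FF : Filter F} (g : I -> V) :
  (forall i, (fun x => f x i) @ F --> g i) -> f @ F --> (g : {ptws I -> V}).
Proof.
move=> fg; apply/cvg_sup => i; apply/cvg_image.
  apply/seteqP; split => // y _; exists (fun j => if j == i then y else g j) => //.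
move=> A /fg Af; exists [set h | A (h i)] => //.
apply/seteqP; split=> [_ [h Ah <-]//|y Ay].
by exists (fun j => if j == i then y else g j); rewrite /= /proj eqxx.
Qed.

(** * Normal functionals *)

Section NormalFunctionals.
Variables (R : realType) (H : completeNormedModType (Cplx R)).
Variable dot : {dot H for conjC}.
Hypothesis hdot : hilbert dot.
Local Notation K := (Cplx R).
Local Notation "T ^*" := (adjoint dot T) : ring_scope.
Implicit Types (h k l : H) (S T : H -> H) (kappa : (H -> H) -> K).

(* Sigma-weak continuity enters only through bounded weakly convergent sequences
   (possibly along an ultrafilter); this class of functionals is visibly stable
   under composition with column maps. *)
Definition weakly_cvg (F : set_system nat) (S_ : nat -> H -> H) S :=
  [/\ forall i, bounded_op (S_ i), bounded_op S,
    exists C : K, forall i, bounded_by C (S_ i)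
  & forall h k, (fun i => dot (S_ i h) k) @ F --> dot (S h) k].

Definition linear_functional kappa := forall (b : K) S T, bounded_op S -> bounded_op T ->
  kappa (b *: S + T) = b * kappa S + kappa T.

Definition normal_functional kappa := linear_functional kappa /\
  forall (F : set_system nat) (S_ : nat -> H -> H) S, ProperFilter F -> weakly_cvg F S_ S ->
    kappa \o S_ @ F --> kappa S.

Lemma bounded_op0 : bounded_op (0 : H -> H).
Proof. by split=> [b h k|h]; [rewrite scaler0 addr0 | exact: cvg_cst]. Qed.

Lemma functional_scale kappa (b : K) S : linear_functional kappa -> bounded_op S ->
  kappa (b *: S) = b * kappa S.
Proof.
move=> lk bS; have k0 : kappa 0 = 0.
  by have := lk (-1) 0 0 bounded_op0 bounded_op0; rewrite scaler0 addr0 mulN1r addNr.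
by rewrite -[b *: S]addr0 lk ?k0 ?addr0 //; exact: bounded_op0.
Qed.

Section SquareSummable.
Variables xi eta : nat -> H.
Hypotheses (sxi : square_summable xi) (seta : square_summable eta).

Lemma square_summable_dominated C S n : bounded_by C S ->
  `|dot (S (xi n)) (eta n)| <= `|C| * (`|xi n| ^+ 2 + `|eta n| ^+ 2).
Proof.
move=> SC; apply: le_trans (cauchy_schwarz hdot _ _) _.
apply: le_trans (_ : `|C| * (`|xi n| * `|eta n|) <= _).
  by rewrite mulrA ler_wpM2r // bounded_by_ge0.
rewrite ler_wpM2l //; apply: le_trans (mul2_le_sqrD (normr_ge0 _) (normr_ge0 _)).
by rewrite mulr_natl mulr2n lerDl mulr_ge0.
Qed.

Lemma square_summable_bound_cvg (C : K) :
  cvgn (series (fun n => C * (`|xi n| ^+ 2 + `|eta n| ^+ 2))).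
Proof.
have -> : series (fun n => C * (`|xi n| ^+ 2 + `|eta n| ^+ 2)) = fun n => C *
   (series (fun n => `|xi n| ^+ 2) n + series (fun n => `|eta n| ^+ 2) n).
  by apply/funext => n; rewrite /series /= -mulr_sumr -big_split.
have /cvg_ex[a ca] := sxi; have /cvg_ex[b cb] := seta.
apply/cvg_ex; exists (C * (a + b)).
apply: cvgMr.
have ca' : series (fun n => `|xi n| ^+ 2) @ \oo --> (a : K) by exact: ca.
have cb' : series (fun n => `|eta n| ^+ 2) @ \oo --> (b : K) by exact: cb.
apply: cvgD.
exact: ca'.
exact: cb'.
Qed.

Lemma pairing_cvg S : bounded_op S -> cvgn (series (fun n => dot (S (xi n)) (eta n))).
Proof.
move=> /bounded_opP[lS [C C0 SC]].
apply: (@series_dominated_cvg _ K _ _ (@Cplx_seq_complete R)).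
  by move=> n; exact: square_summable_dominated.
exact: square_summable_bound_cvg.
Qed.

(** The common bound of a weakly convergent sequence gives a majorant independent of the index, so
    the limit passes through the sum by dominated convergence. *)
Lemma pairing_normal : normal_functional (fun S => limn (series (fun n => dot (S (xi n)) (eta n)))).
Proof.
split=> [b S T bS bT|F S_ S PF [bSi bS [C SC] SS]].
  have e : series (fun n => dot ((b *: S + T) (xi n)) (eta n)) =
      (fun n => b * series (fun n => dot (S (xi n)) (eta n)) n
       + series (fun n => dot (T (xi n)) (eta n)) n).
    apply/funext => n; rewrite /series /= mulr_sumr -big_split /=; apply: eq_bigr => i _.
    by rewrite -dotZl -dotDl.
  have cS := pairing_cvg bS; have cT := pairing_cvg bT.
  rewrite e; apply: cvg_lim; first exact: norm_hausdorff.
  apply: cvgD; last exact: cT.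
  apply: cvgMr; exact: cS.
apply: (@dominated_series _ K _ F _ _ _ _ (@Cplx_seq_complete R)).
- by move=> i n; exact: square_summable_dominated (SC i).
- exact: square_summable_bound_cvg.
- by move=> n; exact: SS.
Qed.

End SquareSummable.

Lemma normal_functional0 : normal_functional (fun=> 0).
Proof. by split=> [b S T _ _|*]; [rewrite mulr0 addr0 | exact: cvg_cst]. Qed.

Lemma normal_functional_lincomb (b : K) kappa kappa' :
  normal_functional kappa -> normal_functional kappa' ->
  normal_functional (fun S => b * kappa S + kappa' S).
Proof.
move=> [l1 n1] [l2 n2]; split=> [c S T bS bT|F S_ S PF SS].
  by rewrite l1 // l2 //; ring.
by apply: cvgD; [apply: cvgMr; exact: n1 | exact: n2].
Qed.

(** A functional vanishing on the common kernel of finitely many others is a combination of them.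
    Restricting to the kernel of the head [f] uses up one functional; on [X] the remaining error is
    a multiple of [f]. Although [psi] is linear on [X] only, [kappa] is linear on all bounded
    operators. *)
Lemma functional_in_span (X : set (H -> H)) (psi : (H -> H) -> K) (fs : seq ((H -> H) -> K)) :
  (forall f, List.In f fs -> normal_functional f) ->
  X `<=` @bounded_op R H -> (forall (b : K) S T, X S -> X T -> X (b *: S + T)) ->
  (forall (b : K) S T, X S -> X T -> psi (b *: S + T) = b * psi S + psi T) ->
  (forall S, X S -> (forall f, List.In f fs -> f S = 0) -> psi S = 0) ->
  exists2 kappa, normal_functional kappa & forall S, X S -> psi S = kappa S.
Proof.
elim: fs X => [|f fs IH] X nfs bX lX lpsi ker.
  exists (fun=> 0); first exact: normal_functional0.
  by move=> S XS; apply: ker.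
have nf : normal_functional f by apply: nfs; left.
have lf (b : K) S T : X S -> X T -> f (b *: S + T) = b * f S + f T.
  by move=> XS XT; apply: nf.1; exact: bX.
have [|||||kappa nk kP] := IH [set S | X S /\ f S = 0].
- by move=> g gfs; apply: nfs; right.
- by move=> S [/bX].
- move=> b S T [XS fS] [XT fT]; split; first exact: lX.
  by rewrite lf // fS fT mulr0 addr0.
- by move=> b S T [XS _] [XT _]; exact: lpsi.
- by move=> S [XS fS] fsS; apply: ker => // g [<-//|]; exact: fsS.
have [[e [Xe fe]]|f0] := pselect (exists e, X e /\ f e != 0); last first.
  exists kappa => // S XS; apply: kP; split=> //.
  by apply: contrapT => /eqP fS; apply: f0; exists S.
exists (fun S => (psi e - kappa e) / f e * f S + kappa S).
  exact: normal_functional_lincomb.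
move=> S XS; pose c := - (f S / f e).
have XS' : X (c *: e + S) by exact: lX.
have /kP : [set S | X S /\ f S = 0] (c *: e + S).
  by split=> //; rewrite lf // /c mulNr divfK // addNr.
rewrite lpsi // nk.1 //; [|exact: bX|exact: bX].
move=> /eqP; rewrite -(inj_eq (addrI (- (c * psi e)))) addKr => /eqP ->.
by rewrite /c; field.
Qed.

Let sw := @sigma_weak_functional R H dot.

(** The sets [base p] generate a filter along which every functional of the defining family tends to
    its value at 0, so each neighbourhood of 0 in the initial topology contains one of them. *)
Lemma sigma_weak_nbhs0 (A : set (sigma_weak dot)) : nbhs (0 : sigma_weak dot) A ->
  exists (us : seq (@square_summable_pairs R H)) (e : R), 0 < e /\
    forall S, (forall u, List.In u us -> `|sw S u| < e%:C%C) -> A S.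
Proof.
pose base (p : seq (@square_summable_pairs R H) * R) : set (H -> H) :=
  [set S | forall u, List.In u p.1 -> `|sw S u| < p.2%:C%C].
pose G := filter_from [set p | 0 < p.2] base.
have FG : Filter G.
  apply: filter_from_filter; first by exists ([::], 1) => /=.
  move=> [us1 e1] [us2 e2] /= e10 e20; exists (us1 ++ us2, Num.min e1 e2) => /=.
    by rewrite lt_min e10.
  move=> S SU; split=> u uu.
    have : List.In u (us1 ++ us2) by apply/List.in_app_iff; left.
    by move=> /SU/lt_le_trans; apply; rewrite lecR ge_min lexx.
  have : List.In u (us1 ++ us2) by apply/List.in_app_iff; right.
  by move=> /SU/lt_le_trans; apply; rewrite lecR ge_min lexx orbT.
have sw0 u : sw 0 u = 0.
  rewrite /sw /sigma_weak_functional; apply/cvg_lim => //.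
  rewrite (_ : series _ = fun=> 0); first exact: cvg_cst.
  by apply/funext => n; rewrite /series /= big1 // => i _; rewrite dot0l.
have swG : sw @ G --> (sw 0 : {ptws @square_summable_pairs R H -> K}).
  apply: filter_cvg_ptws => u; rewrite sw0; apply/cvgrPdist_lt => e /Cplx_pos[-> e0].
  exists ([:: u], complex.Re e) => // S /= Su; rewrite sub0r normrN; apply: Su; by left.
move=> [B [[C oC <-] C0 CA]].
have /swG[[us e] /= e0 usC] : nbhs (sw 0 : {ptws @square_summable_pairs R H -> K}) C.
  by apply: open_nbhs_nbhs.
by exists us, e; split=> // S Su; apply: CA; exact: usC.
Qed.

Lemma square_summable_delta (h : H) : square_summable (fun n : nat => if n == 0%N then h else 0).
Proof.
apply/cvg_ex; exists (`|h| ^+ 2 : K); apply: cvg_near_cst; near=> n.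
have n0 : (0 < n)%N by near: n; exists 1%N.
rewrite /series /= big_ltn // big_nat_cond big1 ?addr0 // => -[//|i] _ /=.
by rewrite normr0 expr0n.
Unshelve. all: by end_near. Qed.

(** Concentrated at index 0, this pair exhibits T |-> <T h, h> as one of the functionals defining
    the topology. *)
Definition delta_pair (h : H) : (nat -> H) * (nat -> H) :=
  (fun n => if n == 0%N then h else 0, fun n => if n == 0%N then h else 0).

Lemma delta_pairP h : delta_pair h \in @square_summable_pairs R H.
Proof. by apply/mem_set; split; exact: square_summable_delta. Qed.

Lemma sigma_weak_delta S h (u : @square_summable_pairs R H) :
  val u = delta_pair h -> sw S u = dot (S h) h.
Proof.
move=> uh; rewrite /sw /sigma_weak_functional uh; apply: cvg_lim; first exact: norm_hausdorff.
apply: cvg_near_cst; near=> n; have n0 : (0 < n)%N by near: n; exists 1%N.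
rewrite /series /= big_ltn //= big_nat_cond big1 ?addr0 // => -[//|i] _ /=.
by rewrite dot0r.
Unshelve. all: by end_near. Qed.

(** Continuity at 0 alone gives finitely many sigma-weak functionals whose smallness forces |<Phi S
    h, h>| < 1. Their common kernel in [X] is stable under scaling, so <Phi S h, h> vanishes on it
    and [functional_in_span] applies. *)
Lemma normal_on_functional (X : set (H -> H)) Phi h :
  X `<=` @bounded_op R H -> X 0 -> (forall (b : K) S T, X S -> X T -> X (b *: S + T)) ->
  linear_on X Phi -> normal_on dot X Phi ->
  exists2 kappa, normal_functional kappa & forall S, X S -> dot (Phi S h) h = kappa S.
Proof.
move=> bX X0 lX lPhi /subspace_continuousP/(_ _ X0) cPhi.
pose u0 : @square_summable_pairs R H :=
    exist (fun u => u \in @square_summable_pairs R H) _ (delta_pairP h).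
pose psi S := dot (Phi S h) h.
have lpsi (b : K) S T : X S -> X T -> psi (b *: S + T) = b * psi S + psi T.
  by move=> XS XT; rewrite /psi lPhi // -dotZl -dotDl.
have psi0 : psi 0 = 0.
  by have := lpsi (-1) 0 0 X0 X0; rewrite scaler0 addr0 mulN1r addNr.
have nO : nbhs (Phi 0 : sigma_weak dot) [set T | `|sw T u0| < 1].
  have c : {for (Phi 0 : sigma_weak dot), continuous (fun T : sigma_weak dot => sw T u0)}.
    apply: (@continuous_comp _ _ _ (sw : sigma_weak dot -> {ptws _ -> K}) (proj u0)).
      exact: initial_continuous.
    exact: proj_continuous.
  have /cvgrPdist_lt/(_ 1 ltr01) := c; rewrite (@sigma_weak_delta _ h) // -/(psi 0) psi0.
  by apply: filterS => T; rewrite sub0r normrN.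
have [us [e [e0 usP]]] := sigma_weak_nbhs0 (cPhi _ nO).
pose fs := [seq (fun S => sw S u) | u <- us].
have nu (u : @square_summable_pairs R H) : normal_functional (fun S => sw S u).
  have [s1 s2] : square_summable_pairs (val u) by apply: set_mem; exact: valP.
  exact: (pairing_normal s1 s2).
have nfs f : List.In f fs -> normal_functional f by move=> /List.in_map_iff[u [<- _]].
have ker S : X S -> (forall f, List.In f fs -> f S = 0) -> psi S = 0.
  move=> XS Sus; apply: contrapT => /eqP pS.
  have Xc : X ((psi S)^-1 *: S) by rewrite -[_ *: S]addr0; exact: lX.
  have pc : psi ((psi S)^-1 *: S) = 1.
    by rewrite -[X in psi X]addr0 lpsi // psi0 addr0 mulVf.
  suff : `|sw (Phi ((psi S)^-1 *: S)) u0| < 1.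
    by rewrite (@sigma_weak_delta _ h) // -/(psi _) pc normr1 ltxx.
  apply: usP => // u uu.
  rewrite (functional_scale _ (nu u).1 (bX _ XS)).
  have -> : sw S u = 0.
    by apply: (Sus (fun S => sw S u)); apply: (List.in_map (fun u S => sw S u)).
  by rewrite mulr0 normr0 ltcR.
exact: functional_in_span nfs bX lX lpsi ker.
Qed.

End NormalFunctionals.

(** * Column maps paired with normal functionals *)

Section ColumnMapNormality.
Variables (R : realType) (H : completeNormedModType (Cplx R)).
Variable dot : {dot H for conjC}.
Hypothesis hdot : hilbert dot.
Local Notation K := (Cplx R).
Local Notation "T ^*" := (adjoint dot T) : ring_scope.
Implicit Types (h k l : H) (S T : H -> H) (kappa : (H -> H) -> K).
Variable a : nat -> H -> H.
Hypothesis aP : column_isometry dot a.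
Local Notation theta := (column_map dot a).

Lemma column_square_summable h : square_summable (fun n => a n h).
Proof. by apply/cvg_ex; exists (`|h| ^+ 2 : K); exact: column_isometry_norm. Qed.

Lemma column_map_dot_lim S h k : bounded_op S ->
  dot (theta S h) k = limn (series (fun n => dot (S (a n h)) (a n k))).
Proof.
by move=> bS; apply/esym/cvg_lim; [exact: norm_hausdorff | exact: column_map_dot].
Qed.

(** A coefficient of theta(S) is a sigma-weak functional of [S], given by the square summable
    families a_n h and a_n k. *)
Lemma column_map_weakly_cvg (F : set_system nat) (S_ : nat -> H -> H) S : ProperFilter F ->
  weakly_cvg dot F S_ S -> weakly_cvg dot F (theta \o S_) (theta S).
Proof.
move=> PF SS; have [bSi bS [C SC] _] := SS; split.
- by move=> i; exact: bounded_op_column_map.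
- exact: bounded_op_column_map.
- by exists C => i; apply: column_map_bounded => //; exact: bounded_op_lin.
- move=> h k; have [_ nk] := pairing_normal hdot (@column_square_summable h) (@column_square_summable k).
  have := nk F S_ S PF SS; rewrite -column_map_dot_lim //.
  rewrite (_ : _ \o S_ = fun i => dot ((theta \o S_) i h) k) //.
  by apply/funext => i /=; rewrite column_map_dot_lim.
Qed.

Lemma normal_column_map kappa : normal_functional dot kappa ->
  normal_functional dot (kappa \o theta).
Proof.
move=> [lk nk]; split=> [b S T bS bT|F S_ S PF SS] /=.
  by rewrite column_map_lincomb // lk //; exact: bounded_op_column_map.
exact: (nk F (theta \o S_) (theta S) PF (column_map_weakly_cvg PF SS)).
Qed.

Lemma column_term_bounded S n : bounded_op S -> bounded_op ((a n)^* \o S \o a n).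
Proof.
move=> bS; have ba := aP.1 n.
by apply: bounded_op_comp => //; apply: bounded_op_comp => //; exact: bounded_op_adjoint.
Qed.

Definition column_partial S N : H -> H := fun h => series (fun n => (a n)^* (S (a n h))) N.

Lemma column_partialS S N :
  column_partial S N.+1 = (1 : K) *: ((a N)^* \o S \o a N) + column_partial S N.
Proof. by apply/funext => h; rewrite /column_partial seriesSr scale1r addrC. Qed.

Lemma column_partial0 S : column_partial S 0 = 0.
Proof. by apply/funext => h; rewrite /column_partial /series /= big_geq. Qed.

Lemma bounded_op_column_partial S N : bounded_op S -> bounded_op (column_partial S N).
Proof.
move=> bS; elim: N => [|N IH]; first by rewrite column_partial0; exact: bounded_op0.
by rewrite column_partialS; apply: bounded_op_lincomb => //; exact: column_term_bounded.
Qed.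

(** By [column_sum_le] the partial sums obey the same norm bound as [S]; such a uniform bound is
    part of [weakly_cvg]. *)
Lemma column_partial_cvg S : bounded_op S ->
  weakly_cvg dot \oo (column_partial S) (theta S).
Proof.
move=> bS; have /bounded_opP[lS [C C0 SC]] := bS; split.
- by move=> N; exact: bounded_op_column_partial.
- exact: bounded_op_column_map.
- exists C => N h; rewrite -(@ler_pXn2r _ 2) ?nnegrE ?mulr_ge0 // exprMn.
  rewrite /column_partial /series; apply: le_trans (column_sum_le _ _ _ _ _) _ => //.
  apply: le_trans (_ : \sum_(0 <= k < N) C ^+ 2 * `|a k h| ^+ 2 <= _).
    by apply: ler_sum => k _; exact: bounded_by_sqr.
  have cs := @column_isometry_scaled _ _ _ hdot _ aP (C ^+ 2) h.
  apply: series_le_lim cs => k.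
  by rewrite mulr_ge0 // exprn_ge0.
- by move=> h k; apply: cvg_dotl => //; exact: column_map_cvg.
Qed.

Lemma normal_series kappa S : normal_functional dot kappa -> bounded_op S ->
  series (fun n => kappa ((a n)^* \o S \o a n)) @ \oo --> kappa (theta S).
Proof.
move=> [lk nk] bS; have k0 : kappa 0 = 0.
  by have := functional_scale 0 lk bS; rewrite scale0r mul0r.
have -> : series (fun n => kappa ((a n)^* \o S \o a n)) = kappa \o column_partial S.
  apply/funext => N; elim: N => [|N IH] /=.
    by rewrite column_partial0 k0 /series /= big_geq.
  rewrite column_partialS lk ?mul1r; [|exact: column_term_bounded|exact: bounded_op_column_partial].
  by rewrite seriesSr IH addrC.
by apply: nk; exact: column_partial_cvg.
Qed.

End ColumnMapNormality.

(** * Commutants and the modular conjugation *)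

Section Commutants.
Variables (R : realType) (H : completeNormedModType (Cplx R)).
Variable dot : {dot H for conjC}.
Hypothesis hdot : hilbert dot.
Local Notation K := (Cplx R).
Local Notation "T ^*" := (adjoint dot T) : ring_scope.
Implicit Types (h k l : H) (S T x y : H -> H) (N P : set (H -> H)) (E : set H).

Lemma commutant_bounded N : commutant N `<=` @bounded_op R H. Proof. by move=> T []. Qed.

Lemma commutantS N P : N `<=` P -> commutant P `<=` commutant N.
Proof. by move=> NP T [bT cT]; split=> // A /NP/cT. Qed.

Lemma sub_commutant2 N : N `<=` @bounded_op R H -> N `<=` commutant (commutant N).
Proof. by move=> bN T NT; split=> [|A [_ /(_ _ NT)]]; [exact: bN|]. Qed.

Lemma commutant3 N : N `<=` @bounded_op R H ->
  commutant (commutant (commutant N)) = commutant N.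
Proof.
move=> bN; apply/seteqP; split; first by apply: commutantS; exact: sub_commutant2.
by apply: sub_commutant2; exact: commutant_bounded.
Qed.

Lemma commutant_adjoint N T : N `<=` @bounded_op R H -> (forall x, N x -> N (x^*)) ->
  commutant N T -> commutant N (T^*).
Proof.
move=> bN sN [bT cT]; split=> [|A NA]; first exact: bounded_op_adjoint.
have bA := bN _ NA; have bA' := bN _ (sN _ NA).
have := congr1 (adjoint dot) (cT _ (sN _ NA)).
by rewrite (adjoint_comp hdot bT bA') (adjoint_comp hdot bA' bT) (adjointK hdot bA) => ->.
Qed.

Lemma vN_commutant N : N `<=` @bounded_op R H -> (forall x, N x -> N (x^*)) ->
  von_neumann_algebra dot (commutant N).
Proof.
move=> bN sN; split; [exact: commutant_bounded | | exact: commutant3].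
by move=> x; exact: commutant_adjoint.
Qed.

Lemma commutant_id N : commutant N id.
Proof. by split=> //; exact: bounded_op_id. Qed.

Lemma commutant_comp N S T : commutant N S -> commutant N T -> commutant N (S \o T).
Proof.
move=> [bS cS] [bT cT]; split=> [|A NA]; first exact: bounded_op_comp.
by rewrite -compA cT // compA cS.
Qed.

Lemma commutant_lincomb N (b : K) S T : N `<=` @bounded_op R H ->
  commutant N S -> commutant N T -> commutant N (b *: S + T).
Proof.
move=> bN [bS cS] [bT cT]; split=> [|A NA]; first exact: bounded_op_lincomb.
apply/funext => h; have [lA _] := bN _ NA.
by rewrite /= !fctE lA (comp_at (cS _ NA)) (comp_at (cT _ NA)).
Qed.

Section Algebra.
Variable P : set (H -> H).
Hypothesis vP : von_neumann_algebra dot P.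

Lemma vN_bounded x : P x -> bounded_op x. Proof. by case: vP => bP _ _ /bP. Qed.

Lemma vN_adjoint x : P x -> P (x^*). Proof. by case: vP => _ sP _ /sP. Qed.

Lemma vN_id : P id. Proof. by case: vP => _ _ <-; exact: commutant_id. Qed.

Lemma vN_comp x y : P x -> P y -> P (x \o y).
Proof. by case: vP => _ _ <-; exact: commutant_comp. Qed.

Lemma vN_lincomb (b : K) x y : P x -> P y -> P (b *: x + y).
Proof. by case: vP => _ _ <-; apply: commutant_lincomb; exact: commutant_bounded. Qed.

End Algebra.

Lemma vN_generated N P : von_neumann_algebra dot P -> N `<=` P ->
  von_neumann_algebra dot (generated_vN dot N).
Proof.
move=> vP NP; split.
- by move=> x /(_ P (conj vP NP)); exact: vN_bounded.
- by move=> x gx Q [vQ NQ]; apply: vN_adjoint => //; exact: gx.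
- apply/seteqP; split.
    move=> x gx Q [vQ NQ]; have [_ _ <-] := vQ; move: x gx.
    by do 2!apply: commutantS; move=> x; apply.
  apply: sub_commutant2 => x /(_ P (conj vP NP)); exact: vN_bounded.
Qed.

(** The bicommutant of [N] is one of the von Neumann algebras over which the intersection is
    taken. *)
Lemma commutant_generated N T : N `<=` @bounded_op R H -> (forall x, N x -> N (x^*)) ->
  commutant N T -> commutant (generated_vN dot N) T.
Proof.
move=> bN sN cT; split=> [|x gx]; first exact: commutant_bounded cT.
have : commutant (commutant N) x.
  apply: gx; split; last exact: sub_commutant2.
  apply: vN_commutant; first exact: commutant_bounded.
  by move=> y; exact: commutant_adjoint.
by case=> _ /(_ _ cT).
Qed.

Lemma closed_subspace_closure E : E 0 ->
  (forall (b : K) h k, E h -> E k -> E (b *: h + k)) -> closed_subspace (closure E).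
Proof.
move=> E0 EL; split; [exact: closed_closure | exact: subset_closure |].
move=> b h k /closure_seq[u Eu uh] /closure_seq[v Ev vk].
apply: (@seq_closure _ _ _ (fun n => b *: u n + v n)); first by move=> n; exact: EL.
by apply: cvgD => //; apply: cvgZr.
Qed.

Lemma bounded_op_closure E E' T h : bounded_op T -> (forall h, E h -> E' (T h)) ->
  closure E h -> closure E' (T h).
Proof.
move=> bT ET /closure_seq[u Eu uh].
apply: (@seq_closure _ _ _ (T \o u)); first by move=> n; exact: ET.
exact: bounded_op_cvg.
Qed.

Lemma bounded_op_eq_closure E S T h : bounded_op S -> bounded_op T ->
  (forall h, E h -> S h = T h) -> closure E h -> S h = T h.
Proof.
move=> bS bT ST /closure_seq[u Eu uh].
have e : S \o u = T \o u by apply/funext => n; exact: ST.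
have cS : S \o u @ \oo --> S h by exact: bounded_op_cvg.
have cT : T \o u @ \oo --> T h by exact: bounded_op_cvg.
by rewrite e in cS; exact: (cvg_unique _ cS cT).
Qed.

End Commutants.

(** * The conjugation J and right multiplication *)

Section ModularConjugation.
Variables (R : realType) (H : completeNormedModType (Cplx R)).
Variable dot : {dot H for conjC}.
Hypothesis hdot : hilbert dot.
Local Notation K := (Cplx R).
Implicit Types (h k l : H) (x y : H -> H).
Variables (M : set (H -> H)) (xi0 : H) (J : H -> H).
Hypothesis vM : von_neumann_algebra dot M.
Hypothesis dM : closure [set x xi0 | x in M] = setT.
Hypothesis JP : modular_conjugation dot M xi0 J.

Lemma conj_lin (b : K) h k : J (b *: h + k) = b^* *: J h + J k.
Proof. by case: JP. Qed.

Lemma conjD h k : J (h + k) = J h + J k.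
Proof. by rewrite -[h]scale1r conj_lin rmorph1 !scale1r. Qed.

Lemma conj0 : J 0 = 0.
Proof. by apply: (addrI (J 0)); rewrite -conjD !addr0. Qed.

Lemma conjZ (b : K) h : J (b *: h) = b^* *: J h.
Proof. by rewrite -[b *: h]addr0 conj_lin conj0 addr0. Qed.

Lemma conjB h k : J (h - k) = J h - J k.
Proof. by rewrite conjD -scaleN1r conjZ rmorphN1 scaleN1r. Qed.

Lemma conj_norm h : `|J h| = `|h|. Proof. by case: JP. Qed.

Lemma conj_cvg I (F : set_system I) {FF : Filter F} (u : I -> H) h :
  u @ F --> h -> (fun i => J (u i)) @ F --> J h.
Proof.
apply: (@bounded_cvg _ _ H J 1) => [k k'|k]; first exact: conjB.
by rewrite conj_norm mul1r.
Qed.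

Lemma conj_vec x : M x -> J (x xi0) = adjoint dot x xi0.
Proof. by case: JP => _ _; apply. Qed.

Lemma conj_xi0 : J xi0 = xi0.
Proof. by have := conj_vec (vN_id vM); rewrite adjoint_id. Qed.

Lemma conjK h : J (J h) = h.
Proof.
have : closure [set x xi0 | x in M] h by rewrite dM.
move=> /closure_seq[u Mu uh].
have JJ : (fun n => J (J (u n))) = u.
  apply/funext => n; have [x Mx <-] := Mu n.
  rewrite conj_vec // conj_vec; last exact: vN_adjoint.
  by rewrite adjointK //; exact: (vN_bounded vM).
have uJ : (fun n => J (J (u n))) @ \oo --> J (J h) by do 2!apply: conj_cvg.
rewrite JJ in uJ.
exact: (cvg_unique _ uJ uh).
Qed.

(** Polarizing |J(h + k)| = |h + k| gives equal real parts; replacing h by i h gives the imaginary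
    parts, with a sign change due to antilinearity. *)
Lemma dot_conj h k : dot (J h) (J k) = dot k h.
Proof.
have re u v : dot (J u) (J v) + (dot (J u) (J v))^* = dot u v + (dot u v)^*.
  have := conj_norm (u + v); rewrite conjD => /(congr1 (fun t => t ^+ 2)).
  rewrite !(sqr_normD hdot) !conj_norm; exact: addrI.
have r1 := re h k; have := re ('i *: h) k.
rewrite conjZ !dotZl !rmorphM /= conjCK conjCi !mulNr => r2.
rewrite [RHS]dotC; set A := dot (J h) (J k) in r1 r2 *; set B := dot h k in r1 r2 *.
have {}r2 : A^* - A = B - B^*.
  by apply: (mulfI (neq0Ci K)); rewrite !mulrBr addrC r2.
have : (2 : K) * A = 2 * B^*.
  rewrite !mulr_natl !mulr2n.
  have -> : A + A = (A + A^*) - (A^* - A) by ring.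
  by rewrite r1 r2; ring.
by apply: mulfI; rewrite pnatr_eq0.
Qed.

Lemma dot_conjl h k : dot (J h) k = dot (J k) h.
Proof. by rewrite -{1}[k]conjK dot_conj. Qed.

Definition conj_op x : H -> H := J \o x \o J.

Lemma bounded_op_mirror x : bounded_op x -> bounded_op (conj_op x).
Proof.
move=> /bounded_opP[lx [C C0 xC]]; apply/bounded_opP; split.
  by move=> b h k; rewrite /conj_op /= conj_lin lx conj_lin conjCK.
by exists C => // h; rewrite /conj_op /= conj_norm -(conj_norm h).
Qed.

Lemma adjoint_mirror x : bounded_op x -> adjoint dot (conj_op x) = conj_op (adjoint dot x).
Proof.
move=> bx; apply: adjoint_unique => //; first exact: bounded_op_mirror.
by move=> h k; rewrite /conj_op /= dot_conjl (adjointPr hdot _ _ bx) -[in RHS](conjK h) dot_conj.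
Qed.

(** On M xi0 the operator J x J is right multiplication by x^*: J x m^* xi0 = m x^* xi0. *)
Lemma mirror_vec x m : M x -> M m -> conj_op x (m xi0) = m (adjoint dot x xi0).
Proof.
move=> Mx Mm; have bx := vN_bounded vM Mx; have bm := vN_bounded vM Mm.
have Mm' := vN_adjoint vM Mm; have bm' := vN_bounded vM Mm'.
rewrite /conj_op /= (conj_vec Mm) -[x _]/((x \o adjoint dot m) xi0).
rewrite (conj_vec (vN_comp vM Mx Mm')) (adjoint_comp hdot bx bm').
by rewrite (adjointK hdot bm).
Qed.

(** Left and right multiplications commute on M xi0, which is dense. *)
Lemma mirror_commute x y : M x -> M y -> conj_op x \o y = y \o conj_op x.
Proof.
move=> Mx My; apply/funext => h.
have bx := bounded_op_mirror (vN_bounded vM Mx); have by' := vN_bounded vM My.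
apply: (@bounded_op_eq_closure _ _ [set x xi0 | x in M]).
- exact: bounded_op_comp.
- exact: bounded_op_comp.
- move=> _ [m Mm <-] /=; rewrite (mirror_vec Mx Mm).
  exact: (mirror_vec Mx (vN_comp vM My Mm)).
- by rewrite dM.
Qed.

Lemma mirror_xi0 x : M x -> conj_op x xi0 = adjoint dot x xi0.
Proof. by move=> Mx; rewrite /conj_op /= conj_xi0 conj_vec. Qed.

Lemma mirror_comp x y : conj_op (x \o y) = conj_op x \o conj_op y.
Proof. by apply/funext => h; rewrite /conj_op /= conjK. Qed.

Lemma mirrorK x : conj_op (conj_op x) = x.
Proof. by apply/funext => h; rewrite /conj_op /= !conjK. Qed.

End ModularConjugation.

(** * The commutation theorem for the Jones corner *)

Section JonesProjection.
Variables (R : realType) (H : completeNormedModType (Cplx R)).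
Variable dot : {dot H for conjC}.
Hypothesis hdot : hilbert dot.
Local Notation K := (Cplx R).
Local Notation "T ^*" := (adjoint dot T) : ring_scope.
Implicit Types (h k l : H) (x y a b r s : H -> H).
Variables (M P : set (H -> H)) (xi0 : H) (J : H -> H).
Hypothesis vM : von_neumann_algebra dot M.
Hypothesis dM : closure [set x xi0 | x in M] = setT.
Hypothesis JP : modular_conjugation dot M xi0 J.
Hypothesis vP : von_neumann_algebra dot P.
Hypothesis PM : P `<=` M.
Local Notation mirror := (conj_op J).
Local Notation E := (closure [set x xi0 | x in P]).
Local Notation e := (jones_projection dot xi0 P).
Local Notation MeP := (basic_extension J P).

Lemma L2_subspace : closed_subspace E.
Proof.
apply: closed_subspace_closure.
  exists ((-1 : K) *: id + id); first by apply: (vN_lincomb vP); exact: (vN_id vP).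
  by rewrite /= !fctE scaleN1r addNr.
move=> b _ _ [x Px <-] [y Py <-]; exists (b *: x + y) => //.
exact: (vN_lincomb vP).
Qed.

Lemma L2_vec x : P x -> E (x xi0).
Proof. by move=> Px; apply: subset_closure; exists x. Qed.

Lemma L2_xi0 : E xi0. Proof. exact: (L2_vec (vN_id vP)). Qed.

Lemma L2_mul x h : P x -> E h -> E (x h).
Proof.
move=> Px; apply: bounded_op_closure; first exact: (vN_bounded vP).
by move=> _ [y Py <-]; exists (x \o y) => //; exact: (vN_comp vP).
Qed.

Lemma mirror_bounded x : M x -> bounded_op (mirror x).
Proof. by move=> Mx; apply: (bounded_op_mirror JP); exact: (vN_bounded vM). Qed.

Lemma L2_mirror x h : P x -> E h -> E (mirror x h).
Proof.
move=> Px; apply: bounded_op_closure; first exact: (mirror_bounded (PM Px)).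
move=> _ [y Py <-]; rewrite (mirror_vec hdot vM JP (PM Px) (PM Py)).
exists (y \o x^*) => //; apply: (vN_comp vP) => //; exact: (vN_adjoint vP).
Qed.

Lemma L2_conj h : E h -> E (J h).
Proof.
move=> /closure_seq[u Pu uh]; apply: (@seq_closure _ _ _ (J \o u)); last exact: (conj_cvg JP).
move=> n /=; have [x Px <-] := Pu n; rewrite (conj_vec JP (PM Px)).
by exists (x^*) => //; exact: (vN_adjoint vP).
Qed.

Lemma jones_in h : E (e h).
Proof. exact: (orth_proj_in hdot L2_subspace). Qed.

Lemma jones_fix h : E h -> e h = h.
Proof. exact: (orth_proj_fix hdot L2_subspace). Qed.

Lemma jones_bounded : bounded_op e.
Proof. exact: (bounded_op_orth_proj hdot L2_subspace). Qed.

Lemma jones_adjoint : e^* = e.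
Proof. exact: (adjoint_orth_proj hdot L2_subspace). Qed.

Lemma jones_idem : e \o e = e.
Proof. exact: (orth_proj_idem hdot L2_subspace). Qed.

Lemma jones_commute x : P x -> e \o x = x \o e.
Proof.
move=> Px; apply: (orth_proj_commutes hdot L2_subspace); first exact: (vN_bounded vP).
  by move=> h; exact: L2_mul.
by move=> h; apply: L2_mul; exact: (vN_adjoint vP).
Qed.

Lemma jones_mirror x : P x -> e \o mirror x = mirror x \o e.
Proof.
move=> Px; have Px' := vN_adjoint vP Px.
apply: (orth_proj_commutes hdot L2_subspace); first exact: (mirror_bounded (PM Px)).
  by move=> h; exact: L2_mirror.
by move=> h; rewrite (adjoint_mirror hdot vM dM JP (vN_bounded vP Px)); exact: L2_mirror.
Qed.

Lemma basic_extension_mul s x : MeP s -> P x -> s \o mirror x = mirror x \o s.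
Proof. by move=> [_ cs] Px; apply: cs; exists x. Qed.

Lemma basic_extensionP s : bounded_op s -> (forall x, P x -> s \o mirror x = mirror x \o s) -> MeP s.
Proof. by move=> bs cs; split=> // _ [x Px <-]; exact: cs. Qed.

Lemma vN_basic_extension : von_neumann_algebra dot MeP.
Proof.
apply: vN_commutant => //.
  by move=> _ [x Px <-]; exact: (mirror_bounded (PM Px)).
move=> _ [x Px <-]; exists (x^*); first exact: (vN_adjoint vP).
by rewrite (adjoint_mirror hdot vM dM JP (vN_bounded vP Px)).
Qed.

Lemma basic_extension_jones : MeP e.
Proof. by apply: basic_extensionP; [exact: jones_bounded | exact: jones_mirror]. Qed.

Lemma sub_basic_extension : M `<=` MeP.
Proof.
move=> y My; apply: basic_extensionP; first exact: (vN_bounded vM).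
by move=> x Px; rewrite (mirror_commute hdot vM dM JP (PM Px) My).
Qed.

Lemma mirror_commutant x : M x -> commutant P (mirror x).
Proof.
move=> Mx; split; first exact: mirror_bounded.
by move=> y Py; exact: (mirror_commute hdot vM dM JP Mx (PM Py)).
Qed.

Lemma vec_mirror y : P y -> y xi0 = mirror (y^*) xi0.
Proof.
move=> Py; have Py' := vN_adjoint vP Py.
by rewrite (mirror_xi0 hdot vM JP (PM Py')) (adjointK hdot (vN_bounded vP Py)).
Qed.

Lemma L2_ext u v : E u -> E v -> (forall y, P y -> dot u (y xi0) = dot v (y xi0)) -> u = v.
Proof.
move=> Eu Ev uv; apply/eqP; rewrite -subr_eq0 -(dnorm_eq0 dot); apply/eqP.
have : E (u - v) by exact: (subspaceB L2_subspace).
move=> /closure_seq[w Pw wuv].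
have c : (fun n => dot (u - v) (w n)) @ \oo --> dot (u - v) (u - v) by exact: cvg_dotr.
have z : (fun n => dot (u - v) (w n)) = cst 0.
  by apply/funext => n; have [y Py <-] := Pw n; rewrite dotBl (uv _ Py) subrr.
rewrite z in c; exact: (cvg_unique _ c (cvg_cst _)).
Qed.

(** This is e_P (JPJ)' e_P, and [commutant_corner] is e_P P' e_P. On L^2(P) they are the commutants
    of the right and of the left action of P; the aim is that the former is P e_P. *)
Definition jones_corner s := MeP s /\ e \o s \o e = s.

Definition commutant_corner r := commutant P r /\ e \o r \o e = r.

Lemma corner_in s h : e \o s \o e = s -> E (s h).
Proof. by move=> <-; exact: jones_in. Qed.

Lemma corner_adjoint s : bounded_op s -> e \o s \o e = s -> e \o s^* \o e = s^*.
Proof.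
move=> bs es; rewrite -[in RHS]es.
have be := jones_bounded; have bes : bounded_op (e \o s) by exact: bounded_op_comp.
by rewrite (adjoint_comp hdot bes be) (adjoint_comp hdot be bs) jones_adjoint.
Qed.

Lemma jones_corner_adjoint s : jones_corner s -> jones_corner (s^*).
Proof.
move=> [Ms es]; split; first exact: (vN_adjoint vN_basic_extension).
by apply: corner_adjoint => //; exact: (vN_bounded vN_basic_extension).
Qed.

Lemma corner_l s h : e \o s \o e = s -> e (s h) = s h.
Proof. by move=> es; apply: jones_fix; exact: corner_in. Qed.

Lemma corner_r s h : e \o s \o e = s -> s (e h) = s h.
Proof.
move=> es; rewrite -[in RHS]es -[in LHS]es /=.
by rewrite -[e (e h)]/((e \o e) h) jones_idem.
Qed.

Lemma cornerP s : (forall h, e (s h) = s h) -> (forall h, s (e h) = s h) -> e \o s \o e = s.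
Proof. by move=> es se; apply/funext => h /=; rewrite es se. Qed.

Lemma jones_corner_comp s s' : jones_corner s -> jones_corner s' -> jones_corner (s \o s').
Proof.
move=> [Ms es] [Ms' es']; split; first exact: (vN_comp vN_basic_extension).
by apply: cornerP => h /=; [exact: corner_l | rewrite (corner_r _ es')].
Qed.

Lemma jones_corner_scale (c : K) s : jones_corner s -> jones_corner (c *: s).
Proof.
move=> [Ms es]; split.
  rewrite -[c *: s]addr0 -[0](addNr s) -scaleN1r.
  by do 2!apply: (vN_lincomb vN_basic_extension) => //.
have le := bounded_op_lin jones_bounded.
apply: cornerP => h; rewrite !fctE; first by rewrite (linZ le) (corner_l _ es).
by rewrite (corner_r _ es).
Qed.

(** Tested against y xi0 = J y^* J xi0 with y in [P]: [s] commutes with J y^* J, which is moved to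
    the other side, and <J h, k> = <J k, h> does the rest. *)
Lemma jones_corner_conj s : jones_corner s -> s^* xi0 = J (s xi0).
Proof.
move=> cs; have [Ms es] := cs; have [_ es'] := jones_corner_adjoint cs.
have bs := vN_bounded vN_basic_extension Ms.
apply: L2_ext; [exact: corner_in | apply: L2_conj; exact: corner_in |].
move=> y Py; have Py' := vN_adjoint vP Py; have by' := vN_bounded vP Py.
rewrite -(adjointPr hdot _ _ bs) (vec_mirror Py) (comp_at (basic_extension_mul Ms Py')).
rewrite (adjointPr hdot _ _ (mirror_bounded (PM Py'))).
rewrite (adjoint_mirror hdot vM dM JP (vN_bounded vP Py')) (adjointK hdot by').
rewrite (mirror_xi0 hdot vM JP (PM Py)) (mirror_xi0 hdot vM JP (PM Py')) (adjointK hdot by').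
by rewrite -(conj_vec JP (PM Py)) (dot_conjl hdot vM dM JP).
Qed.

Lemma commutant_corner_conj r : commutant_corner r -> r^* xi0 = J (r xi0).
Proof.
move=> [[br cr] er].
apply: L2_ext; [apply: corner_in; exact: corner_adjoint | apply: L2_conj; exact: corner_in |].
move=> y Py; have by' := vN_bounded vP Py.
rewrite -(adjointPr hdot _ _ br) (comp_at (cr _ Py)) (adjointPr hdot _ _ by').
by rewrite -(conj_vec JP (PM Py)) (dot_conjl hdot vM dM JP).
Qed.

Lemma dot_conjr h k : dot h (J k) = dot k (J h).
Proof. by rewrite dotC (dot_conjl hdot vM dM JP) -dotC. Qed.

Lemma mirror_conj x h : mirror x (J h) = J (x h).
Proof. by rewrite /conj_op /= (conjK hdot vM dM JP). Qed.

(** The classical argument that left and right actions on a trace vector are each other's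
    commutants. In <s r x xi0, y xi0> and <r s x xi0, y xi0> the operators are brought onto xi0,
    where s^* xi0 = J s xi0 and r^* xi0 = J r xi0; the symmetry of <h, J k> identifies the
    results. *)
Lemma corners_commute s r : jones_corner s -> commutant_corner r -> s \o r = r \o s.
Proof.
move=> cs cr; have [Ms es] := cs; have [[br crP] er] := cr.
have bs := vN_bounded vN_basic_extension Ms.
have Ms' := vN_adjoint vN_basic_extension Ms.
have rP' y h : P y -> r^* (y h) = y (r^* h).
  move=> Py; apply: comp_at.
  have [|_ c] := @commutant_adjoint _ _ _ hdot P r (vN_bounded vP) (vN_adjoint vP).
    by split.
  exact: c.
suff eq h : E h -> s (r h) = r (s h).
  apply/funext => h /=; rewrite -(corner_r h er) eq; last exact: jones_in.
  by rewrite (corner_r _ es).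
move=> Eh; apply: (bounded_op_eq_closure (bounded_op_comp bs br) (bounded_op_comp br bs) _ Eh).
move=> _ [x Px <-] /=; apply: L2_ext; [exact: corner_in | exact: corner_in |].
move=> y Py; have Px' := vN_adjoint vP Px; have Py' := vN_adjoint vP Py.
have bx := vN_bounded vP Px; have by' := vN_bounded vP Py.
rewrite (adjointP hdot _ _ bs) [RHS](adjointP hdot _ _ br) (comp_at (crP _ Px)).
rewrite (vec_mirror Py) (comp_at (basic_extension_mul Ms' Py')) -(vec_mirror Py).
rewrite (jones_corner_conj cs) mirror_conj.
rewrite (vec_mirror Px) (comp_at (basic_extension_mul Ms Px')).
rewrite (rP' _ _ Py) (commutant_corner_conj cr).
rewrite (adjointPr hdot _ _ by') (comp_at (esym (mirror_commute hdot vM dM JP (PM Px') (PM Py')))).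
rewrite (adjointP hdot _ _ (mirror_bounded (PM Px'))).
rewrite (adjoint_mirror hdot vM dM JP (vN_bounded vP Px')) (adjointK hdot bx) mirror_conj.
exact: dot_conjr.
Qed.

Lemma commutant_corner_square a : commutant P a -> commutant_corner (e \o (a^* \o a) \o e).
Proof.
move=> ca; have bP := @vN_bounded _ _ _ _ vP.
have ca' : commutant P (a^*) by apply: commutant_adjoint => //; exact: vN_adjoint.
have ce : commutant P e by split; [exact: jones_bounded | exact: jones_commute].
split; first exact: (commutant_comp (commutant_comp ce (commutant_comp ca' ca)) ce).
by apply: cornerP => h /=; rewrite -[e (e _)]/((e \o e) _) jones_idem.
Qed.

(** An [a] in P' need not preserve L^2(P), but its form there is that of e a^* a e, which lies in e
    P' e and so commutes with s'^*. *)
Lemma dot_corner_square a s s' : commutant P a -> jones_corner s -> jones_corner s' ->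
  dot (a (s xi0)) (a (s' xi0)) = dot (a ((s'^* \o s) xi0)) (a xi0).
Proof.
move=> ca cs cs'; have [[_ es] [Ms' es']] := (cs, cs').
have ba := commutant_bounded ca; have bs' := vN_bounded vN_basic_extension Ms'.
have cc := corners_commute (jones_corner_adjoint cs') (commutant_corner_square ca).
have ec h k : E h -> E k -> dot (a h) (a k) = dot ((e \o (a^* \o a) \o e) h) k.
  move=> Eh Ek; rewrite /= (jones_fix Eh) (dot_orth_proj hdot L2_subspace _ Ek).
  by rewrite (adjointP hdot _ _ (bounded_op_adjoint hdot ba)) (adjointK hdot ba).
rewrite ec; [|exact: corner_in|exact: corner_in].
rewrite (adjointPr hdot _ _ bs') (comp_at cc) -ec //; last exact: L2_xi0.
have [_ es'c] := jones_corner_adjoint cs'; exact: corner_in.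
Qed.

(* If |a (t xi0)| <= al + m for all self-adjoint contractions t of the corner, then
   |a (t xi0)| ^ 2 <= |a (t^2 xi0)| al <= (al + m) al <= (al + m / 2) ^ 2. *)
Lemma selfadjoint_corner_le a s : commutant P a -> jones_corner s -> s^* = s ->
  bounded_by 1 s -> `|a (s xi0)| <= `|a xi0|.
Proof.
move=> ca cs ss s1; have /bounded_opP[la [C C0 aC]] := commutant_bounded ca.
pose c := C * `|xi0|; have c0 : 0 <= c by rewrite mulr_ge0.
set al := `|a xi0|; have al0 : 0 <= al by exact: normr_ge0.
(* The error starts at c, from the plain norm bound. Halving it at each squaring is relaxed to
   passing from c / (n + 1) to c / (n + 2), as n + 2 <= 2 (n + 1); the error then tends to 0 like
   the harmonic sequence. *)
have step n : forall t, jones_corner t -> t^* = t -> bounded_by 1 t ->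
    `|a (t xi0)| <= al + c * n.+1%:R^-1.
  elim: n => [|n IH] t ct tt t1.
    rewrite invr1 mulr1; apply: le_trans (_ : c <= _); last by rewrite lerDr.
    apply: le_trans (aC _) _; rewrite ler_wpM2l //.
    by have := t1 xi0; rewrite mul1r.
  have ct2 := jones_corner_comp ct ct.
  have bt := vN_bounded vN_basic_extension ct.1.
  have IHt : `|a ((t \o t) xi0)| <= al + c * n.+1%:R^-1.
    apply: IH => //; first by rewrite (adjoint_comp hdot bt bt) tt.
    by move=> h; rewrite mul1r /=; have := t1 (t h); have := t1 h; rewrite !mul1r => h1 /le_trans; apply.
  have k0 : 0 <= c * n.+2%:R^-1 by rewrite mulr_ge0 // invr_ge0.
  have k1 : c * n.+1%:R^-1 <= 2 * (c * n.+2%:R^-1).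
    rewrite mulrCA ler_wpM2l // -ler_pdivrMl // -invfM lef_pV2 ?posrE ?mulr_gt0 //.
    by rewrite -natrM ler_nat mul2n -addnn addSn addnS !ltnS leq_addr.
  rewrite -(@ler_pXn2r _ 2) ?nnegrE ?addr_ge0 //.
  rewrite hdot (dot_corner_square ca ct ct) tt -[dot _ _]ger0_norm; last first.
    by rewrite -{1}tt -(dot_corner_square ca ct ct) dot_ge0.
  apply: le_trans (cauchy_schwarz hdot _ _) _; rewrite -/al.
  apply: le_trans (ler_wpM2r al0 IHt) _.
  apply: le_trans (_ : (al + 2 * (c * n.+2%:R^-1)) * al <= _).
    by rewrite ler_wpM2r // lerD2l.
  set m := c * _ in k0 k1 *; rewrite -subr_ge0.
  have -> : (al + m) ^+ 2 - (al + 2 * m) * al = m ^+ 2 by ring.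
  by rewrite exprn_ge0.
apply: (@cvg_ler _ _ \oo _ (fun=> `|a (s xi0)|) (fun n => al + c * (harmonic n)%:C%C)).
- exact: cvg_cst.
- rewrite -[X in _ --> X]addr0 -[X in _ --> _ + X](mulr0 c); apply: cvgD; first exact: cvg_cst.
  by apply: cvgMr; exact: (cvg_real_complex cvg_harmonic).
- by move=> n; have := step n s cs ss s1; rewrite /harmonic /= fmorphV /= rmorph_nat.
Qed.

(** One has |a s xi0|^2 = <a s^* s xi0, a xi0>, and s^* s / C^2 is a self-adjoint contraction of the
    corner. *)
Lemma jones_corner_le a s C : commutant P a -> jones_corner s -> 0 < C -> bounded_by C s ->
  `|a (s xi0)| <= C * `|a xi0|.
Proof.
move=> ca cs C0 sC; have bs := vN_bounded vN_basic_extension cs.1.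
have cs' := jones_corner_adjoint cs; have cp := jones_corner_comp cs' cs.
have bs' := bounded_op_adjoint hdot bs.
have sC' : bounded_by C (s^*) by apply: bounded_by_adjoint => //; exact: ltW.
have bp : bounded_op (s^* \o s) by exact: bounded_op_comp.
have C2 : 0 < C ^+ 2 by rewrite exprn_gt0.
have la := bounded_op_lin (commutant_bounded ca).
pose p := (C ^- 2) *: (s^* \o s).
have cr : conjC (C ^- 2) = C ^- 2 by rewrite conj_Creal // ger0_real // invr_ge0 ltW.
have p1 : `|a (p xi0)| <= `|a xi0|.
  apply: selfadjoint_corner_le => //; first exact: jones_corner_scale.
    apply: adjoint_unique => //.
      by have := @bounded_op_lincomb R H (C ^- 2) _ _ bp (@bounded_op0 R H); rewrite addr0.
    move=> h k; rewrite /p !fctE dotZl dotZr cr; congr (_ * _) => /=.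
    by rewrite -(adjointPr hdot _ _ bs) (adjointP hdot _ _ bs).
  move=> h; rewrite /p !fctE normrZ ger0_norm ?invr_ge0 ?(ltW C2) // mul1r ler_pdivrMl //.
  by rewrite expr2 -mulrA; apply: le_trans (sC' _) _; rewrite ler_pM2l //; exact: sC.
rewrite -(@ler_pXn2r _ 2) ?nnegrE ?mulr_ge0 ?(ltW C0) // hdot (dot_corner_square ca cs cs).
rewrite -[dot _ _]ger0_norm; last by rewrite -(dot_corner_square ca cs cs) dot_ge0.
apply: le_trans (cauchy_schwarz hdot _ _) _.
rewrite exprMn [`|a xi0| ^+ 2]expr2 mulrA ler_wpM2r //.
by move: p1; rewrite /p !fctE (linZ la) normrZ ger0_norm ?invr_ge0 ?(ltW C2) // ler_pdivrMl.
Qed.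

(* The closure of a xi0 |-> a (s xi0), a in P': by jones_corner_le it is the graph
   of a bounded operator, which commutes with P' and so lies in P'' = P. *)
Definition corner_graph s h k := exists u : nat -> H -> H, [/\ forall n, commutant P (u n),
  (fun n => u n xi0) @ \oo --> h & (fun n => u n (s xi0)) @ \oo --> k].

Lemma commutant_subr a b : commutant P a -> commutant P b -> commutant P ((-1 : K) *: b + a).
Proof. by move=> ca cb; apply: commutant_lincomb => //; exact: (vN_bounded vP). Qed.

Section Extension.
Variables (s : H -> H) (C : K).
Hypotheses (cs : jones_corner s) (C0 : 0 < C) (sC : bounded_by C s).

Lemma corner_graph_lin (b : K) h k h' k' : corner_graph s h k -> corner_graph s h' k' ->
  corner_graph s (b *: h + h') (b *: k + k').
Proof.
move=> [u [Pu uh uk]] [v [Pv vh vk]]; exists (fun n => b *: u n + v n); split.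
- by move=> n; apply: commutant_lincomb => //; exact: (vN_bounded vP).
- by apply: cvgD => //; apply: cvgZr.
- by apply: cvgD => //; apply: cvgZr.
Qed.

Lemma corner_graph_le h k : corner_graph s h k -> `|k| <= C * `|h|.
Proof.
move=> [u [Pu uh uk]].
apply: (@cvg_ler _ _ \oo _ (fun n => `|u n (s xi0)|) (fun n => C * `|u n xi0|)).
- exact: cvg_norm.
- by apply: cvgMr; exact: cvg_norm.
- by move=> n; exact: (jones_corner_le (Pu n) cs C0 sC).
Qed.

Lemma corner_graph_mul b h k : commutant P b -> corner_graph s h k -> corner_graph s (b h) (b k).
Proof.
move=> cb [u [Pu uh uk]]; exists (fun n => b \o u n); have bb := commutant_bounded cb; split.
- by move=> n; exact: commutant_comp.
- exact: (bounded_op_cvg bb uh).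
- exact: (bounded_op_cvg bb uk).
Qed.

Lemma corner_graph_vec a : commutant P a -> corner_graph s (a xi0) (a (s xi0)).
Proof. by move=> ca; exists (fun=> a); split=> //; exact: cvg_cst. Qed.

(** P' contains JMJ and J x^* J xi0 = x xi0, so P' xi0 is dense. Along an approximating sequence the
    vectors u_n s xi0 are Cauchy, by [jones_corner_le] applied to differences. *)
Lemma corner_graph_total h : exists k, corner_graph s h k.
Proof.
have : closure [set x xi0 | x in M] h by rewrite dM.
move=> /closure_seq[v Mv vh].
have /choice[u uP] n : exists a, commutant P a /\ a xi0 = v n.
  have [x Mx <-] := Mv n; exists (mirror (x^*)).
  have Mx' := vN_adjoint vM Mx; split; first exact: mirror_commutant.
  by rewrite (mirror_xi0 hdot vM JP Mx') (adjointK hdot (vN_bounded vM Mx)).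
have uh : (fun n => u n xi0) @ \oo --> h.
  by have -> : (fun n => u n xi0) = v by apply/funext => n; exact: (uP n).2.
suff /cvg_ex[k uk] : cvgn (fun n => u n (s xi0)).
  by exists k; exists u; split=> // n; exact: (uP n).1.
apply: complete_seq_complete; apply/cauchy_ballP => d d0.
have dC : 0 < d / C by rewrite divr_gt0.
have /cvg_cauchy/cauchy_ballP/(_ _ dC) : cvgn (fun n => u n xi0) by apply/cvg_ex; exists h.
case=> -[A B] [/= [N1 _ A1] [N2 _ B2]] AB.
exists ([set u m (s xi0) | m in [set m | (maxn N1 N2 <= m)%N]],
        [set u m (s xi0) | m in [set m | (maxn N1 N2 <= m)%N]]).
  by split; exists (maxn N1 N2) => // m Mm; exists m.
move=> [_ _] [[/= m Mm <-] [n Mn <-]]; rewrite -ball_normE /=.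
have : `|u m xi0 - u n xi0| < d / C.
  have := AB (u m xi0, u n xi0); rewrite -ball_normE /=; apply; split.
    by apply: A1 => /=; exact: leq_trans (leq_maxl _ _) Mm.
  by apply: B2 => /=; exact: leq_trans (leq_maxr _ _) Mn.
rewrite ltr_pdivlMr // mulrC; apply: le_lt_trans.
have := jones_corner_le (commutant_subr (uP m).1 (uP n).1) cs C0 sC.
by rewrite !fctE !scaleN1r ![- _ + _]addrC.
Qed.

Lemma corner_extension : exists2 x, P x & x \o e = s.
Proof.
have /choice[x xP] := corner_graph_total.
have uniq h k : corner_graph s h k -> x h = k.
  move=> hk; apply/eqP; rewrite eq_sym -subr_eq0 -normr_le0.
  have := corner_graph_le (corner_graph_lin (-1) (xP h) hk).
  by rewrite !scaleN1r addNr normr0 mulr0 addrC.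
have bx : bounded_op x.
  apply/bounded_opP; split.
    by move=> b h k; apply: uniq; apply: corner_graph_lin; exact: xP.
  by exists C; [exact: ltW | move=> h; apply: corner_graph_le; exact: xP].
have Px : P x.
  have [_ _ <-] := vP; split=> // b cb; apply/funext => h /=.
  by apply: uniq; apply: corner_graph_mul => //; exact: xP.
exists x => //; have [Ms es] := cs; have bs := vN_bounded vN_basic_extension Ms.
apply/funext => h /=; rewrite -(corner_r h es).
(* On P xi0 the extension agrees with [s]: y xi0 = J y^* J xi0, where J y^* J lies in P' and
   commutes with [s]. *)
have st k : [set x xi0 | x in P] k -> x k = s k.
  move=> [y Py <-]; have Py' := vN_adjoint vP Py.
  rewrite (vec_mirror Py) (comp_at (basic_extension_mul Ms Py')).
  by apply: uniq; apply: corner_graph_vec; apply: mirror_commutant; exact: PM.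
exact: (bounded_op_eq_closure bx bs st (@jones_in h)).
Qed.

End Extension.

Lemma jones_cornerP s : jones_corner s -> exists2 x, P x & x \o e = s.
Proof.
move=> cs; have /bounded_opP[_ [C C0 sC]] := vN_bounded vN_basic_extension cs.1.
(* [C] may vanish, and the extension needs a positive bound to divide by. *)
apply: (@corner_extension s (C + 1)) => //; first by rewrite ltr_wpDl.
by move=> h; rewrite mulrDl mul1r (le_trans (sC h)) // lerDl.
Qed.

Lemma jones_corner_mul x : P x -> jones_corner (x \o e).
Proof.
move=> Px; have Mx := sub_basic_extension (PM Px).
split; first by apply: (vN_comp vN_basic_extension) => //; exact: basic_extension_jones.
apply: cornerP => h /=; last by rewrite -[e (e h)]/((e \o e) h) jones_idem.
by rewrite (comp_at (jones_commute Px)) -[e (e h)]/((e \o e) h) jones_idem.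
Qed.

Lemma corner_basic_extension : [set x \o e | x in P] = corner e MeP.
Proof.
apply/seteqP; split=> [_ [x Px <-]|_ [s Ms <-]].
  have [Ms es] := jones_corner_mul Px; by exists (x \o e).
apply: jones_cornerP; split.
  have Me := basic_extension_jones; have vB := vN_basic_extension.
  exact: (vN_comp vB (vN_comp vB Me Ms) Me).
by apply: cornerP => h /=; rewrite -[e (e _)]/((e \o e) _) jones_idem.
Qed.

End JonesProjection.

(** * Weak limits and iterates of column maps *)

Section WeakLimits.
Variables (R : realType) (H : completeNormedModType (Cplx R)).
Variable dot : {dot H for conjC}.
Hypothesis hdot : hilbert dot.
Local Notation K := (Cplx R).
Local Notation "T ^*" := (adjoint dot T) : ring_scope.
Implicit Types (h k l : H) (S T : H -> H) (kappa : (H -> H) -> K).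

Lemma normal_vec h k : normal_functional dot (fun S => dot (S h) k).
Proof.
split=> [b S T _ _|F S_ S PF [_ _ _]]; first by rewrite !fctE dotDl dotZl.
exact.
Qed.

Lemma normal_mulr kappa T : bounded_op T -> normal_functional dot kappa ->
  normal_functional dot (fun S => kappa (S \o T)).
Proof.
move=> bT [lk nk]; split=> [b S S' bS bS'|F S_ S PF [bSi bS [C SC] SS]].
  by apply: (lk b (S \o T) (S' \o T)); exact: bounded_op_comp.
apply: (nk F (fun i => S_ i \o T) (S \o T) PF); split.
- by move=> i; exact: bounded_op_comp.
- exact: bounded_op_comp.
- have /bounded_opP[_ [D D0 TD]] := bT; exists (`|C| * D) => i h /=.
  apply: le_trans (bounded_by_ge0 (SC i) _) _.
  by rewrite -mulrA ler_wpM2l //; exact: TD.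
- by move=> h k; exact: SS.
Qed.

Lemma normal_mull kappa T : bounded_op T -> normal_functional dot kappa ->
  normal_functional dot (fun S => kappa (T \o S)).
Proof.
move=> bT [lk nk]; split=> [b S S' bS bS'|F S_ S PF [bSi bS [C SC] SS]].
  rewrite -(lk b (T \o S) (T \o S')); [|exact: bounded_op_comp|exact: bounded_op_comp].
  by congr kappa; apply/funext => h /=; rewrite !fctE (bounded_op_lin bT).
apply: (nk F (fun i => T \o S_ i) (T \o S) PF); split.
- by move=> i; exact: bounded_op_comp.
- exact: bounded_op_comp.
- have /bounded_opP[_ [D D0 TD]] := bT; exists (D * C) => i h /=.
  apply: le_trans (TD _) _.
  by rewrite -mulrA ler_wpM2l //; exact: SC.
- move=> h k; have := SS h (T^* k).
  rewrite -(adjointP hdot _ _ bT).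
  by under eq_fun do rewrite -(adjointP hdot _ _ bT).
Qed.

(** Weak compactness of operator balls: the coefficients converge along [U] and [riesz] represents
    the limit form. Limits are taken of <k, A_i h>, which is linear in k as [riesz] requires. *)
Lemma weak_ultra_limit (U : set_system nat) (A_ : nat -> H -> H) (C : K) :
  UltraFilter U -> 0 <= C -> (forall i, bounded_op (A_ i)) -> (forall i, bounded_by C (A_ i)) ->
  exists t, weakly_cvg dot U A_ t.
Proof.
move=> UU C0 bA AC; have PU : ProperFilter U := ultra_proper.
have Ab h k i : `|dot k (A_ i h)| <= C * `|h| * `|k|.
  apply: le_trans (cauchy_schwarz hdot _ _) _; rewrite mulrC ler_wpM2r //; exact: AC.
have /choice[f fP] (p : H * H) : exists l : K, (fun i => dot p.2 (A_ i p.1)) @ U --> l.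
  have BE : C * `|p.1| * `|p.2| = (complex.Re (C * `|p.1| * `|p.2|))%:C%C.
    by apply: Cplx_ge0; rewrite !mulr_ge0.
  apply: (@bounded_ultra_cvg _ _ _ _ (complex.Re (C * `|p.1| * `|p.2|)) UU).
  by apply: filterE => i; rewrite -BE.
have fC h k : `|f (h, k)| <= C * `|h| * `|k|.
  apply: (@cvg_ler _ _ U _ (fun i => `|dot k (A_ i h)|) (fun=> C * `|h| * `|k|)).
  - by apply: cvg_norm; exact: (fP (h, k)).
  - exact: cvg_cst.
  - by move=> i.
have fl h (b : K) k k' : f (h, b *: k + k') = b * f (h, k) + f (h, k').
  have c : (fun i => dot (b *: k + k') (A_ i h)) @ U --> b * f (h, k) + f (h, k').
    under eq_fun do rewrite dotDl dotZl.
    by apply: cvgD; [apply: cvgMr; exact: (fP (h, k)) | exact: (fP (h, k'))].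
  exact: (cvg_unique _ (fP (h, b *: k + k')) c).
have /choice[t tP] h : exists v, forall k, f (h, k) = dot k v.
  by apply: (@riesz _ _ dot hdot _ (C * `|h|)); [exact: fl | exact: fC].
have tc h k : (fun i => dot (A_ i h) k) @ U --> dot (t h) k.
  rewrite dotC -tP; under eq_fun do rewrite dotC.
  by apply: cvg_conjC; exact: (fP (h, k)).
have tC : bounded_by C t.
  move=> h; have [->|n0] := eqVneq (t h) 0; first by rewrite normr0 mulr_ge0.
  rewrite -(ler_pM2r (_ : 0 < `|t h|)) ?normr_gt0 // -expr2 hdot -tP.
  by apply: le_trans (fC h (t h)); rewrite tP -hdot ger0_norm ?exprn_ge0.
have tl : linear t.
  move=> b h h'; apply: (@dot_inj _ _ dot) => k.
  have c : (fun i => dot (A_ i (b *: h + h')) k) @ U --> dot (b *: t h + t h') k.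
    rewrite dotDl dotZl; under eq_fun do rewrite (bounded_op_lin (bA _)) dotDl dotZl.
    by apply: cvgD; [apply: cvgMr; exact: tc | exact: tc].
  exact: (cvg_unique _ (tc (b *: h + h') k) c).
exists t; split=> //; last by exists C.
by apply/bounded_opP; split=> //; exists C.
Qed.

Variable a : nat -> H -> H.
Hypothesis aP : column_isometry dot a.
Local Notation theta := (column_map dot a).

Lemma column_map_mono S T : bounded_op S -> bounded_op T ->
  (forall h, dot (S h) h <= dot (T h) h) -> forall h, dot (theta S h) h <= dot (theta T h) h.
Proof.
move=> bS bT ST h.
have cS : series (fun n => dot (S (a n h)) (a n h)) @ \oo --> dot (theta S h) h by exact: column_map_dot.
have cT : series (fun n => dot (T (a n h)) (a n h)) @ \oo --> dot (theta T h) h by exact: column_map_dot.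
apply: (cvg_ler cS cT) => n.
by rewrite /series /=; apply: ler_sum.
Qed.

Lemma column_map_id : theta id = id.
Proof.
apply/funext => h; apply: cvg_lim; first exact: norm_hausdorff.
exact: aP.2.
Qed.

Lemma iter_bounded i S : bounded_op S -> bounded_op (iter i theta S).
Proof. by move=> bS; elim: i => //= i IH; exact: bounded_op_column_map. Qed.

Lemma iter_bounded_by i S C : bounded_op S -> bounded_by C S -> bounded_by C (iter i theta S).
Proof.
move=> bS SC; elim: i => //= i IH; apply: column_map_bounded => //.
exact: bounded_op_lin (iter_bounded i bS).
Qed.

Lemma iter_normal i kappa : normal_functional dot kappa ->
  normal_functional dot (fun S => kappa (iter i theta S)).
Proof.
elim: i kappa => [//|i IH] kappa nk.
exact: (IH _ (normal_column_map hdot aP nk)).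
Qed.

Lemma iter_pos i S : bounded_op S -> (forall h, 0 <= dot (S h) h) ->
  forall h, 0 <= dot (iter i theta S h) h.
Proof.
move=> bS S0; elim: i => //= i IH; apply: column_map_pos => //; exact: iter_bounded.
Qed.

(** Each step applies Kadison-Schwarz to theta^i(S), then the monotonicity of theta to the
    inequality already proved. *)
Lemma iter_schwarz i S h : bounded_op S ->
  `|iter i theta S h| ^+ 2 <= dot (iter i theta (S^* \o S) h) h.
Proof.
move=> bS; have bSS := bounded_op_comp (bounded_op_adjoint hdot bS) bS.
elim: i h => [|i IH] h /=; first by rewrite hdot -(adjointPr hdot _ _ bS) /=.
have bi := iter_bounded i bS.
apply: le_trans (column_map_schwarz hdot aP h bi) _.
apply: column_map_mono.
- exact: (bounded_op_comp (bounded_op_adjoint hdot bi) bi).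
- exact: iter_bounded.
- by move=> k /=; rewrite -(adjointPr hdot _ _ bi) -hdot.
Qed.

Lemma iter_column_mull i S T : bounded_op S -> bounded_op T -> (forall n, T^* \o a n = a n \o T^*) ->
  iter i theta (T \o S) = T \o iter i theta S.
Proof.
move=> bS bT Ta; elim: i => //= i ->; apply: column_map_mull => //; exact: iter_bounded.
Qed.

Lemma iter_column_mulr i S T : bounded_op S -> bounded_op T -> (forall n, T \o a n = a n \o T) ->
  iter i theta (S \o T) = iter i theta S \o T.
Proof.
move=> bS bT Ta; elim: i => //= i ->; apply: column_map_mulr => //; exact: iter_bounded.
Qed.

Lemma iter_column_lincomb i (b : K) S T : bounded_op S -> bounded_op T ->
  iter i theta (b *: S + T) = b *: iter i theta S + iter i theta T.
Proof.
move=> bS bT; elim: i => //= i ->; apply: column_map_lincomb => //; exact: iter_bounded.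
Qed.

End WeakLimits.

(** * Harmonic operators *)

Section HarmonicOperators.
Variables (R : realType) (H : completeNormedModType (Cplx R)).
Variable dot : {dot H for conjC}.
Hypothesis hdot : hilbert dot.
Local Notation K := (Cplx R).
Local Notation "T ^*" := (adjoint dot T) : ring_scope.
Implicit Types (h k l : H) (S T x y : H -> H).
Variables (M : set (H -> H)) (xi0 : H) (J : H -> H) (z : nat -> H -> H).
Hypothesis vM : von_neumann_algebra dot M.
Hypothesis dM : closure [set x xi0 | x in M] = setT.
Hypothesis JP : modular_conjugation dot M xi0 J.
Hypothesis zS : frakS dot M z.
Local Notation P := (generated_vN dot (range z)).
Local Notation E := (closure [set x xi0 | x in P]).
Local Notation e := (jones_projection dot xi0 P).
Local Notation MeP := (basic_extension J P).
Local Notation mirror := (conj_op J).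
Local Notation Hphi := (harmonic_operators (Ad_sum dot J z)).

Lemma sqr_cvg0 (F : set_system nat) {FF : Filter F} (u v : nat -> K) :
  (forall i, `|u i| ^+ 2 <= v i) -> v @ F --> (0 : K) -> u @ F --> (0 : K).
Proof.
move=> uv /cvgrPdist_lt v0; apply/cvgrPdist_lt => d d0.
apply: filterS (v0 _ (exprn_gt0 2 d0)) => i; rewrite !sub0r !normrN => vd.
rewrite -(@ltr_pXn2r _ 2) ?nnegrE ?(ltW d0) ?normr_ge0 //.
apply: le_lt_trans (uv i) _; apply: le_lt_trans vd.
by rewrite ger0_norm // (le_trans _ (uv i)) // exprn_ge0.
Qed.

(** Parallelogram law for the form of [T]: the two sides differ by <T (h - k), h - k>. *)
Lemma pos_form_le T h k : linear T -> (forall h, 0 <= dot (T h) h) ->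
  dot (T (h + k)) (h + k) <= 2 * dot (T h) h + 2 * dot (T k) k.
Proof.
move=> lT T0; rewrite -subr_ge0.
have -> : 2 * dot (T h) h + 2 * dot (T k) k - dot (T (h + k)) (h + k) = dot (T (h - k)) (h - k).
  by rewrite !(linD lT) (linN lT) !dotDl !dotDr !dotNl !dotNr; ring.
exact: T0.
Qed.

(** The adjoint makes d_n^* = J z_n J, so that [phi] is a column map with column d_n, and it gives
    d_n xi0 = z_n xi0. *)
Definition mirrored n : H -> H := mirror ((z n)^*).
Local Notation d := mirrored.
Local Notation theta := (column_map dot z).
Local Notation phi := (column_map dot d).

Lemma frakS_in n : M (z n). Proof. by case: zS. Qed.

Lemma frakS_bounded n : bounded_op (z n). Proof. exact: (vN_bounded vM (frakS_in n)). Qed.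

Lemma frakS_adjoint n : exists m, (z n)^* = z m. Proof. by case: zS. Qed.

Lemma range_frakS_bounded : range z `<=` @bounded_op R H.
Proof. by move=> _ [n _ <-]; exact: frakS_bounded. Qed.

Lemma range_frakS_adjoint x : range z x -> range z (x^*).
Proof. by move=> [n _ <-]; have [m ->] := frakS_adjoint n; exists m. Qed.

Lemma range_frakS_sub : range z `<=` M.
Proof. by move=> _ [n _ <-]; exact: frakS_in. Qed.

Lemma vN_P : von_neumann_algebra dot P.
Proof. exact: (vN_generated vM range_frakS_sub). Qed.

Lemma P_sub : P `<=` M.
Proof. by move=> x; apply; split=> //; exact: range_frakS_sub. Qed.

Lemma frakS_P n : P (z n).
Proof. by move=> Q [_]; apply; exists n. Qed.

Lemma frakS_isometry : column_isometry dot z.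
Proof. by case: (zS) => _ _ zz _; split=> //; exact: frakS_bounded. Qed.

Lemma mirrored_bounded n : bounded_op (d n).
Proof. by apply: (bounded_op_mirror JP); apply: bounded_op_adjoint => //; exact: frakS_bounded. Qed.

Lemma mirrored_adjoint n : (d n)^* = mirror (z n).
Proof.
have bz := frakS_bounded n.
by rewrite (adjoint_mirror hdot vM dM JP (bounded_op_adjoint hdot bz)) (adjointK hdot bz).
Qed.

(** This is the relation sum z_n z_n^* = 1 conjugated by [J]; the other relation makes [z] itself a
    column isometry. *)
Lemma mirrored_isometry : column_isometry dot d.
Proof.
split=> [|h]; first exact: mirrored_bounded.
have [_ /(_ (J h)) zz _ _] := zS.
have c : (fun n => J (series (fun n => (z n \o (z n)^*) (J h)) n)) @ \oo --> h.
  by rewrite -[X in _ --> X](conjK hdot vM dM JP); exact: (conj_cvg JP).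
rewrite (_ : series _ = fun n => J (series (fun n => (z n \o (z n)^*) (J h)) n)); first exact: c.
apply/funext => n; rewrite /series /=; elim: n => [|n IH].
  by rewrite !big_geq // (conj0 JP).
rewrite !big_nat_recr //= (conjD JP) IH; congr (_ + _).
by rewrite mirrored_adjoint /mirrored /conj_op /= (conjK hdot vM dM JP).
Qed.

Lemma mirrored_xi0 n : d n xi0 = z n xi0.
Proof.
rewrite /mirrored (mirror_xi0 hdot vM JP (vN_adjoint vM (frakS_in n))).
by rewrite (adjointK hdot (frakS_bounded n)).
Qed.

Lemma Ad_sumE T : Ad_sum dot J z T = phi T.
Proof.
apply/funext => h; rewrite /Ad_sum /column_map.
rewrite (_ : (fun n => Ad dot (J \o z n \o J) T h) = fun n => (d n)^* (T (d n h))) //.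
apply/funext => n; rewrite mirrored_adjoint /Ad /=.
by rewrite (adjoint_mirror hdot vM dM JP (frakS_bounded n)).
Qed.

Lemma harmonicP T : Hphi T <-> bounded_op T /\ phi T = T.
Proof. by rewrite /harmonic_operators /= Ad_sumE. Qed.

Lemma mirrored_commute n m : d n \o z m = z m \o d n.
Proof. exact: (mirror_commute hdot vM dM JP (vN_adjoint vM (frakS_in n)) (frakS_in m)). Qed.

Lemma mirrored_adjoint_commute n m : (d n)^* \o z m = z m \o (d n)^*.
Proof. rewrite mirrored_adjoint; exact: (mirror_commute hdot vM dM JP (frakS_in n) (frakS_in m)). Qed.

Lemma vacuum_theta_phi S : bounded_op S -> dot (theta S xi0) xi0 = dot (phi S xi0) xi0.
Proof.
move=> bS; have c1 : series (fun n => dot (S (z n xi0)) (z n xi0)) @ \oo --> dot (theta S xi0) xi0.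
  exact: (column_map_dot hdot frakS_isometry bS).
have c2 : series (fun n => dot (S (d n xi0)) (d n xi0)) @ \oo --> dot (phi S xi0) xi0.
  exact: (column_map_dot hdot mirrored_isometry bS).
have e12 : (fun n => dot (S (d n xi0)) (d n xi0)) = (fun n => dot (S (z n xi0)) (z n xi0)).
  by apply/funext => n; rewrite mirrored_xi0.
rewrite e12 in c2; exact: (cvg_unique _ c1 c2).
Qed.

Lemma theta_sandwich i n S : bounded_op S ->
  iter i theta ((d n)^* \o S \o d n) = (d n)^* \o iter i theta S \o d n.
Proof.
move=> bS; have bd := mirrored_bounded n; have bd' := bounded_op_adjoint hdot bd.
have bSd := bounded_op_comp bS bd.
rewrite -compA (iter_column_mull hdot frakS_isometry) //; last first.
  by move=> m; rewrite (adjointK hdot bd); exact: mirrored_commute.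
by rewrite (iter_column_mulr hdot frakS_isometry) // => m; exact: mirrored_commute.
Qed.

(** The map theta^i is carried through the infinite sum phi(S) by normality of S |-> <theta^i(S) h,
    k>; each term is handled by [theta_sandwich], the d_n commuting with the z_m. *)
Lemma theta_phi_commute i S : bounded_op S -> iter i theta (phi S) = phi (iter i theta S).
Proof.
move=> bS; have bi := iter_bounded hdot frakS_isometry i bS.
apply/funext => h; apply: (@dot_inj _ _ dot) => k.
have c1 := normal_series hdot mirrored_isometry
  (iter_normal hdot frakS_isometry i (@normal_vec _ _ dot h k)) bS.
have c2 : series (fun n => dot (iter i theta S (d n h)) (d n k)) @ \oo -->
    dot (phi (iter i theta S) h) k.
  exact: (column_map_dot hdot mirrored_isometry bi).
have e12 : (fun n => dot (iter i theta ((d n)^* \o S \o d n) h) k) =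
    (fun n => dot (iter i theta S (d n h)) (d n k)).
  apply/funext => n; rewrite theta_sandwich //=.
  by rewrite -(adjointPr hdot _ _ (mirrored_bounded n)).
rewrite e12 in c1; exact: (cvg_unique _ c1 c2).
Qed.

Lemma vacuum_iterS i S : bounded_op S ->
  dot (iter i.+1 theta S xi0) xi0 = dot (iter i theta (phi S) xi0) xi0.
Proof.
move=> bS; rewrite theta_phi_commute //= vacuum_theta_phi //.
exact: (iter_bounded hdot frakS_isometry).
Qed.

(** * Spreading decay from the trace vector to L^2(P) *)

Section SmallVectors.
Variable S : H -> H.
Hypothesis bS : bounded_op S.
Local Notation A := (S^* \o S).
Local Notation g i h := (dot (iter i theta A h) h).

(** Applied with [S] the commutator of T and d_n, whose decay is known at xi0 and is needed on all
    of L^2(P). *)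
Definition small_vectors : set H := [set h | (fun i => g i h) @ \oo --> (0 : K)].

Lemma square_pos h : 0 <= dot (A h) h.
Proof. by rewrite /= -(adjointPr hdot _ _ bS) dot_ge0. Qed.

Lemma square_bounded : bounded_op A.
Proof. by apply: bounded_op_comp => //; exact: bounded_op_adjoint. Qed.

Lemma iter_square_pos i h : 0 <= g i h.
Proof. exact: (iter_pos hdot frakS_isometry i square_bounded square_pos). Qed.

Lemma iter_square_lin i : linear (iter i theta A).
Proof. exact: (bounded_op_lin (iter_bounded hdot frakS_isometry i square_bounded)). Qed.

Lemma small_lincomb (b : K) h k : small_vectors h -> small_vectors k -> small_vectors (b *: h + k).
Proof.
rewrite /small_vectors /= => sh sk.
apply: (@cvg0_le _ _ _ _ K _ (fun i => 2 * (`|b| ^+ 2 * g i h) + 2 * g i k)).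
  move=> i; rewrite ger0_norm ?iter_square_pos //.
  apply: le_trans (pos_form_le _ _ (iter_square_lin i) (iter_square_pos i)) _.
  by rewrite lerD2r (linZ (iter_square_lin i)) dotZl dotZr normCK [b * (conjC b * _)]mulrA.
have c : (fun i => 2 * (`|b| ^+ 2 * g i h) + 2 * g i k) @ \oo --> 2 * (`|b| ^+ 2 * 0) + 2 * (0 : K).
  exact: (cvgD (cvgMr (cvgMr sh)) (cvgMr sk)).
by rewrite !mulr0 addr0 in c; exact: c.
Qed.

Lemma small_closed_subspace : closed_subspace small_vectors.
Proof.
split; last exact: small_lincomb; last first.
  have z0 : (fun i => g i (0 : H)) = fun=> (0 : K).
    by apply/funext => i; rewrite (lin0 (iter_square_lin i)) dot0l.
  rewrite /small_vectors /= z0; exact: (cvg_cst (0 : K)).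
have /bounded_opP[_ [C C0 AC]] := square_bounded.
have gC i h : g i h <= C * (`|h| * `|h|).
  rewrite -[leLHS]ger0_norm ?iter_square_pos //; apply: le_trans (cauchy_schwarz hdot _ _) _.
  rewrite mulrA ler_wpM2r //; exact: (iter_bounded_by hdot frakS_isometry i square_bounded AC).
apply: seq_closed => u h su uh; apply/cvgrPdist_le => r r0.
have r4 : 0 < r / 4 by rewrite divr_gt0.
have c : (fun j => C * (`|u j - h| * `|u j - h|)) @ \oo --> C * (`|h - h| * `|h - h|).
  have c1 : (fun j => `|u j - h|) @ \oo --> `|h - h|.
    by apply: cvg_norm; apply: cvgB => //; exact: cvg_cst.
  exact: (cvgMr (cvgM c1 c1)).
rewrite subrr normr0 !mulr0 in c.
move/cvgrPdist_le: c => /(_ _ r4)[j _ /(_ j (leqnn j))]; rewrite sub0r normrN => cj.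
have sj : (fun i => g i (u j)) @ \oo --> (0 : K) by exact: (su j).
move/cvgrPdist_le: sj => /(_ _ r4).
apply: filterS => i; rewrite !sub0r !normrN => gu.
rewrite ger0_norm ?iter_square_pos // -[h](subrK (u j)).
apply: le_trans (pos_form_le _ _ (iter_square_lin i) (iter_square_pos i)) _.
have h1 : g i (h - u j) <= r / 4.
  apply: le_trans (gC _ _) _; apply: le_trans cj.
  by rewrite ger0_norm ?mulr_ge0 // distrC.
have h2 : g i (u j) <= r / 4 by rewrite -[leLHS]ger0_norm ?iter_square_pos.
have -> : r = 2 * (r / 4) + 2 * (r / 4) by field.
by apply: lerD; rewrite ler_pM2l.
Qed.

(** The number <theta^i(A) z_n h, z_n h> is a single term of the positive series for <theta^(i+1)(A)
    h, h>. *)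
Lemma small_frakS n h : small_vectors h -> small_vectors (z n h).
Proof.
rewrite /small_vectors /= => sh.
apply: (@cvg0_le _ _ _ _ K _ (fun i => g i.+1 h)).
  move=> i; rewrite ger0_norm ?iter_square_pos //=.
  apply: (column_map_term_le hdot frakS_isometry); last exact: iter_square_pos.
  exact: (iter_bounded hdot frakS_isometry i square_bounded).
by move: sh; rewrite -(@cvg_shiftS _ (fun i => g i h) (nbhs 0)).
Qed.

(** Products of the z_n do not exhaust [P]; but the projection onto the small vectors commutes with
    every z_n and z_n^*, hence with [P], and it fixes xi0. *)
Lemma small_L2 : small_vectors xi0 -> E `<=` small_vectors.
Proof.
move=> s0; have sW := small_closed_subspace; pose p := orth_proj dot small_vectors.
have cp : commutant P p.
  apply: (commutant_generated hdot range_frakS_bounded range_frakS_adjoint).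
  split=> [|_ [n _ <-]]; first exact: (bounded_op_orth_proj hdot sW).
  apply: (orth_proj_commutes hdot sW (frakS_bounded n)); first by move=> h; exact: small_frakS.
  by have [m ->] := frakS_adjoint n; move=> h; exact: small_frakS.
have [cW _ _] := sW; rewrite closure_id in cW.
rewrite cW; apply: closureS => _ [x Px <-].
rewrite -[X in x X](orth_proj_fix hdot sW s0) -(comp_at (cp.2 _ Px)).
exact: (orth_proj_in hdot sW).
Qed.

Lemma small_cvg h k : small_vectors h -> (fun i => dot (iter i theta S h) k) @ \oo --> (0 : K).
Proof.
rewrite /small_vectors /= => sh; apply: (@sqr_cvg0 _ _ _ (fun i => `|k| ^+ 2 * g i h)).
  move=> i; apply: le_trans (_ : (`|iter i theta S h| * `|k|) ^+ 2 <= _).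
    by rewrite ler_pXn2r ?nnegrE ?mulr_ge0 //; exact: cauchy_schwarz.
  by rewrite exprMn mulrC ler_wpM2l ?exprn_ge0 //; exact: (iter_schwarz hdot frakS_isometry).
rewrite -(mulr0 (`|k| ^+ 2)); exact: cvgMr.
Qed.

End SmallVectors.

(** * Asymptotic commutation of a harmonic operator with J P J *)

Section Harmonic.
Variable T : H -> H.
Hypotheses (bT : bounded_op T) (hT : phi T = T).

Lemma vacuum_harmonic i : dot (iter i theta T xi0) xi0 = dot (T xi0) xi0.
Proof. by elim: i => // i IH; rewrite vacuum_iterS // hT. Qed.

Lemma harmonic_adjoint : phi (T^*) = T^*.
Proof. by rewrite (column_map_adjoint hdot mirrored_isometry bT) hT. Qed.

Definition mirror_defect n : H -> H := (-1 : K) *: (d n \o T) + (T \o d n).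
Local Notation D := mirror_defect.

Lemma mirror_defect_bounded n : bounded_op (D n).
Proof.
have bd := mirrored_bounded n.
rewrite /mirror_defect; exact: (bounded_op_lincomb (-1) (bounded_op_comp bd bT) (bounded_op_comp bT bd)).
Qed.

Lemma mirror_defect_adjoint n : (D n)^* = (-1 : K) *: (T^* \o (d n)^*) + ((d n)^* \o T^*).
Proof.
have bd := mirrored_bounded n; have bdT := bounded_op_comp bd bT; have bTd := bounded_op_comp bT bd.
apply: adjoint_unique => //; first exact: mirror_defect_bounded.
move=> h k; rewrite /mirror_defect !fctE !scaleN1r !dotDl !dotDr dotNl dotNr /=.
by rewrite (adjointP hdot _ _ bd) !(adjointP hdot _ _ bT) (adjointP hdot _ _ bd).
Qed.

Lemma defect_functional f n : normal_functional dot f ->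
  f ((D n)^* \o D n) = f ((d n)^* \o (T^* \o T) \o d n)
    - f (((d n)^* \o T^* \o d n) \o T) - f (T^* \o ((d n)^* \o T \o d n))
    + f (T^* \o (((d n)^* \o id \o d n) \o T)).
Proof.
move=> [lf _]; have bd := mirrored_bounded n; have bd' := bounded_op_adjoint hdot bd.
have bT' := bounded_op_adjoint hdot bT; have bi := @bounded_op_id R H.
set A1 := (d n)^* \o (T^* \o T) \o d n; set A2 := ((d n)^* \o T^* \o d n) \o T.
set A3 := T^* \o ((d n)^* \o T \o d n); set A4 := T^* \o (((d n)^* \o id \o d n) \o T).
have b1 : bounded_op A1 := bounded_op_comp (bounded_op_comp bd' (bounded_op_comp bT' bT)) bd.
have b2 : bounded_op A2 := bounded_op_comp (bounded_op_comp (bounded_op_comp bd' bT') bd) bT.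
have b3 : bounded_op A3 := bounded_op_comp bT' (bounded_op_comp (bounded_op_comp bd' bT) bd).
have b4 : bounded_op A4 :=
  bounded_op_comp bT' (bounded_op_comp (bounded_op_comp (bounded_op_comp bd' bi) bd) bT).
have -> : (D n)^* \o D n = (-1 : K) *: A2 + ((-1 : K) *: A3 + ((1 : K) *: A1 + A4)).
  rewrite mirror_defect_adjoint /mirror_defect; apply/funext => h /=; rewrite !fctE !scaleN1r scale1r /=.
  have ld := bounded_op_lin bd'; have lT := bounded_op_lin bT'.
  do 3!rewrite ?(linD ld) ?(linD lT) ?(linN ld) ?(linN lT).
  rewrite /A1 /A2 /A3 /A4 /=.
  move: (T^* ((d n)^* (d n (T h)))) (T^* ((d n)^* (T (d n h)))) => p q.
  move: ((d n)^* (T^* (d n (T h)))) ((d n)^* (T^* (T (d n h)))) => r s.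
  rewrite opprD opprK [LHS]addrCA; congr (_ + _); rewrite [p - q]addrC -addrA.
  by congr (_ + _); exact: addrC.
have b14 := @bounded_op_lincomb _ _ 1 _ _ b1 b4.
have b134 := @bounded_op_lincomb _ _ (-1) _ _ b3 b14.
rewrite (lf _ _ _ b2 b134) (lf _ _ _ b3 b14) (lf _ _ _ b1 b4); ring.
Qed.

(** Harmonicity of T and T^* and phi(1) = 1 turn the last three sums into f(T^* T), with signs -, -,
    +. *)
Lemma defect_series f : normal_functional dot f ->
  series (fun n => f ((D n)^* \o D n)) @ \oo --> f (phi (T^* \o T)) - f (T^* \o T).
Proof.
move=> nf; have bT' := bounded_op_adjoint hdot bT; have bTT := bounded_op_comp bT' bT.
pose s1 n := f ((d n)^* \o (T^* \o T) \o d n).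
pose s2 n := f (((d n)^* \o T^* \o d n) \o T).
pose s3 n := f (T^* \o ((d n)^* \o T \o d n)).
pose s4 n := f (T^* \o (((d n)^* \o id \o d n) \o T)).
have c1 : series s1 @ \oo --> f (phi (T^* \o T)) := normal_series hdot mirrored_isometry nf bTT.
have c2 : series s2 @ \oo --> f (T^* \o T).
  rewrite -[X in X \o T]harmonic_adjoint.
  exact: (normal_series hdot mirrored_isometry (normal_mulr bT nf) bT').
have c3 : series s3 @ \oo --> f (T^* \o T).
  rewrite -[X in _ \o X]hT.
  exact: (normal_series hdot mirrored_isometry (normal_mull hdot bT' nf) bT).
have c4 : series s4 @ \oo --> f (T^* \o T).
  have -> : T^* \o T = T^* \o (phi id \o T) by rewrite (column_map_id mirrored_isometry).
  have nf' := normal_mulr bT (normal_mull hdot bT' nf).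
  exact: (normal_series hdot mirrored_isometry nf' (@bounded_op_id R H)).
have -> : series (fun n => f ((D n)^* \o D n)) =
    fun n => series s1 n - series s2 n - series s3 n + series s4 n.
  apply/funext => n; rewrite /series /= -!sumrB -big_split /=; apply: eq_bigr => i _.
  exact: defect_functional.
rewrite -[X in _ --> X](subrK (f (T^* \o T))).
exact: (cvgD (cvgB (cvgB c1 c2) c3) c4).
Qed.

Local Notation vac i S := (dot (iter i theta S xi0) xi0).

Lemma vacuum_normal i : normal_functional dot (fun S => vac i S).
Proof. exact: (iter_normal hdot frakS_isometry i (@normal_vec _ _ dot xi0 xi0)). Qed.

Lemma defect_vacuum_le n i :
  vac i ((D n)^* \o D n) <= vac i.+1 (T^* \o T) - vac i (T^* \o T).
Proof.
have c := defect_series (vacuum_normal i).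
(* At the vacuum, theta^i applied to phi(T^* T) is one more iterate of theta. *)
rewrite (vacuum_iterS i (square_bounded bT)).
have := @series_le_lim _ _ _ n n.+1 _ c; rewrite big_nat1; apply => m.
have bD := mirror_defect_bounded m.
exact: (iter_pos hdot frakS_isometry i (square_bounded bD) (square_pos bD)).
Qed.

Lemma defect_vacuum_cvg n : (fun i => vac i ((D n)^* \o D n)) @ \oo --> (0 : K).
Proof.
have bTT := square_bounded bT; have bD := mirror_defect_bounded n.
have posD i : 0 <= vac i ((D n)^* \o D n).
  exact: (iter_pos hdot frakS_isometry i (square_bounded bD) (square_pos bD)).
have pos i : 0 <= vac i (T^* \o T).
  exact: (iter_pos hdot frakS_isometry i bTT (square_pos bT)).
have /cvg_ex[l vl] : cvgn (fun i => vac i (T^* \o T)).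
  have /bounded_opP[_ [C C0 TC]] := bTT.
  apply: (@nondecreasing_Cplx_cvgn R _ (C * `|xi0| * `|xi0|)) => // i.
    by rewrite -subr_ge0; apply: le_trans (defect_vacuum_le n i).
  rewrite -[leLHS]ger0_norm //; apply: le_trans (cauchy_schwarz hdot _ _) _.
  rewrite ler_wpM2r //; exact: (iter_bounded_by hdot frakS_isometry i bTT TC).
have vl' : (fun i => vac i.+1 (T^* \o T)) @ \oo --> l.
  by move: vl; rewrite -(@cvg_shiftS _ (fun i => vac i (T^* \o T)) (nbhs l)).
apply: (@cvg0_le _ _ _ _ K _ (fun i => vac i.+1 (T^* \o T) - vac i (T^* \o T))).
  by move=> i; rewrite ger0_norm //; exact: defect_vacuum_le.
rewrite -(subrr l); exact: (cvgB vl' vl).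
Qed.

Lemma defect_cvg n h k : E h -> (fun i => dot (iter i theta (D n) h) k) @ \oo --> (0 : K).
Proof.
move=> Eh; have bD := mirror_defect_bounded n; apply: (small_cvg bD).
exact: (small_L2 bD (@defect_vacuum_cvg n) Eh).
Qed.

(** Both d_n and d_n^* commute with every z_m, so theta^i passes to [T] inside the commutator; decay
    of the left side thus becomes commutation of the weak limit with d_n. *)
Lemma iter_defect i n :
  iter i theta (D n) = (-1 : K) *: (d n \o iter i theta T) + (iter i theta T \o d n).
Proof.
have bd := mirrored_bounded n; have I := frakS_isometry.
rewrite (iter_column_lincomb hdot I i (-1) (bounded_op_comp bd bT) (bounded_op_comp bT bd)).
rewrite (iter_column_mull hdot I i bT bd (mirrored_adjoint_commute n)).
by rewrite (iter_column_mulr hdot I i bT bd (mirrored_commute n)).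
Qed.

Hypothesis eT : e \o T \o e = T.

Lemma harmonic_limit : exists U t, [/\ ProperFilter U, \oo `<=` U,
  weakly_cvg dot U (fun i => iter i theta T) t & jones_corner dot P xi0 J t].
Proof.
have [U [UU sU]] := ultraFilterLemma (eventually_filter : ProperFilter \oo).
have PU : ProperFilter U := ultra_proper.
have I := frakS_isometry; have /bounded_opP[_ [C C0 TC]] := bT.
have bA i := iter_bounded hdot I i bT.
have [t wt] := weak_ultra_limit hdot UU C0 bA (fun i => iter_bounded_by hdot I i bT TC).
have [_ bt _ tc] := wt.
have be : bounded_op e := jones_bounded hdot xi0 vN_P.
have ez m : e \o z m = z m \o e := jones_commute hdot xi0 vN_P (frakS_P m).
have ea : e^* = e := jones_adjoint hdot xi0 vN_P.
have es h k : dot (e h) k = dot h (e k) by rewrite (adjointP hdot _ _ be) ea.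
(* Since e_P commutes with every z_m, being compressed by it survives theta^i, and then the weak
   limit. *)
have eAe i : e \o iter i theta T \o e = iter i theta T.
  rewrite -[in RHS]eT (iter_column_mulr hdot I i (bounded_op_comp be bT) be ez).
  by rewrite (iter_column_mull hdot I i bT be) // => m; rewrite ea; exact: ez.
have et : e \o t \o e = t.
  apply/funext => h /=; apply: (@dot_inj _ _ dot) => k.
  have c : (fun i => dot (iter i theta T h) k) @ U --> dot (e (t (e h))) k.
    have -> : (fun i => dot (iter i theta T h) k) = (fun i => dot (iter i theta T (e h)) (e k)).
      by apply/funext => i; rewrite -[in LHS](eAe i) /= es.
    by rewrite es; exact: tc.
  exact: (cvg_unique _ c (tc h k)).
have td n : t \o d n = d n \o t.
  have bd := mirrored_bounded n.
  (* Decay is known on L^2(P) only; as t = e t e and d_n commutes with e, commutation there is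
     enough. *)
  have tE h : E h -> t (d n h) = d n (t h).
    move=> Eh; apply: (@dot_inj _ _ dot) => k.
    have c1 : (fun i => dot (iter i theta (D n) h) k) @ U --> (0 : K).
      have c0 : (fun i => dot (iter i theta (D n) h) k) @ \oo --> (0 : K) by exact: defect_cvg.
      by move=> B /c0; exact: sU.
    have c2 : (fun i => dot (iter i theta (D n) h) k) @ U --> dot (t (d n h)) k - dot (d n (t h)) k.
      rewrite (_ : (fun i => _) =
          fun i => dot (iter i theta T (d n h)) k - dot (iter i theta T h) ((d n)^* k)).
        by rewrite (adjointP hdot (t h) k bd); exact: (cvgB (tc _ _) (tc _ _)).
      apply/funext => i; rewrite iter_defect !fctE scaleN1r dotDl dotNl addrC /=.
      by rewrite (adjointP hdot _ k bd).
    by apply/eqP; rewrite -subr_eq0; apply/eqP; exact: (cvg_unique _ c2 c1).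
  have ed : e \o d n = d n \o e.
    exact: (jones_mirror hdot vM dM JP vN_P P_sub (vN_adjoint vN_P (frakS_P n))).
  apply/funext => h /=; rewrite -[LHS](corner_r hdot vN_P _ et) (comp_at ed) tE.
    by rewrite (corner_r hdot vN_P _ et).
  exact: (jones_in hdot vN_P).
exists U, t; split; [exact: PU | exact: sU | exact: wt |]; split; last exact: et.
apply: basic_extensionP => // x Px.
have mc := mirror_comp hdot vM dM JP; have mK := mirrorK hdot vM dM JP.
(* Commutation with the d_n is extended to all of JPJ by conjugating with [J]: J t J commutes with
   the z_m, hence with the algebra they generate. *)
have ct : commutant P (mirror t).
  apply: (commutant_generated hdot range_frakS_bounded range_frakS_adjoint); split.
    exact: (bounded_op_mirror JP bt).
  move=> _ [m _ <-]; have [j zj] := frakS_adjoint m.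
  have <- : (z j)^* = z m by rewrite -zj (adjointK hdot (frakS_bounded m)).
  have mt := congr1 mirror (td j); rewrite (mc t (d j)) (mc (d j) t) /mirrored mK in mt; exact: mt.
have mt := congr1 mirror (ct.2 _ Px); rewrite (mc (mirror t) x) (mc x (mirror t)) mK in mt; exact: mt.
Qed.

End Harmonic.

(** Common core of both parts, for a space of operators compressed by e_P. Compatibility with
    conjugation by z_n is a separate assumption because z_n itself need not lie in P e_P. *)
Lemma vacuum_rigidity (X : set (H -> H)) (Phi : (H -> H) -> H -> H) :
  X `<=` Hphi -> (forall S, X S -> e \o S \o e = S) -> X 0 ->
  (forall (b : K) S T, X S -> X T -> X (b *: S + T)) ->
  (forall x, P x -> X (x \o e)) -> (forall n S, X S -> X ((z n)^* \o S \o z n)) ->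
  (forall S, X S -> Hphi (Phi S)) -> linear_on X Phi -> normal_on dot X Phi ->
  (forall n S, X S -> Phi ((z n)^* \o S \o z n) = (z n)^* \o Phi S \o z n) ->
  (forall x, P x -> dot (Phi (x \o e) xi0) xi0 = dot (x xi0) xi0) ->
  forall S, X S -> dot (Phi S xi0) xi0 = dot (S xi0) xi0.
Proof.
move=> Xh Xe X0 lX PX zX hPhi lPhi nPhi zPhi PhiP S XS; have I := frakS_isometry.
have bX : X `<=` @bounded_op R H by move=> T /Xh/harmonicP[].
have [kappa nk kP] := normal_on_functional hdot xi0 bX X0 lX lPhi nPhi.
(* Since theta(T) need not lie in [X], the induction hypothesis is applied to the terms z_n^* T z_n;
   normality sums them to theta^i(theta(T)), while harmonicity of Phi(T) evaluates the same sum as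
   <Phi(T) xi0, xi0>. *)
have stationary i T : X T -> kappa T = kappa (iter i theta T).
  elim: i T => // i IH T XT; have [bPT hPT] := (harmonicP _).1 (hPhi _ XT).
  have c1 := normal_series hdot I (iter_normal hdot I i nk) (bX _ XT).
  have c2 : series (fun n => dot (Phi T (d n xi0)) (d n xi0)) @ \oo --> dot (phi (Phi T) xi0) xi0.
    exact: (column_map_dot hdot mirrored_isometry bPT).
  have e12 : (fun n => kappa (iter i theta ((z n)^* \o T \o z n))) =
      (fun n => dot (Phi T (d n xi0)) (d n xi0)).
    apply/funext => n; rewrite -IH; last exact: zX.
    rewrite -kP; last exact: zX.
    by rewrite zPhi //= mirrored_xi0 (adjointPr hdot _ _ (frakS_bounded n)).
  rewrite e12 in c1; rewrite iterSr -kP // -[in LHS]hPT.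
  exact: (cvg_unique _ c2 c1).
have [bS hS] := (harmonicP _).1 (Xh _ XS).
have [U [t [PU sU wt ct]]] := harmonic_limit bS hS (Xe _ XS).
have [x Px xt] := jones_cornerP hdot vM dM JP vN_P P_sub ct.
have Xt : X t by rewrite -xt; exact: PX.
have [_ _ _ tc] := wt.
have e1 : kappa S = kappa t.
  have c : (fun i => kappa (iter i theta S)) @ U --> kappa t := nk.2 _ _ _ PU wt.
  have e2 : (fun i => kappa (iter i theta S)) = fun=> kappa S.
    by apply/funext => i; rewrite -stationary.
  rewrite e2 in c; exact: (cvg_unique _ (cvg_cst (kappa S)) c).
have e3 : dot (t xi0) xi0 = dot (S xi0) xi0.
  have c := tc xi0 xi0.
  have e2 : (fun i => dot (iter i theta S xi0) xi0) = fun=> dot (S xi0) xi0.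
    by apply/funext => i; exact: vacuum_harmonic.
  rewrite e2 in c; exact: (cvg_unique _ c (cvg_cst (dot (S xi0) xi0))).
rewrite kP // e1 -kP // -e3 -xt PhiP //=.
by rewrite (jones_fix hdot vN_P (@L2_xi0 _ _ dot P xi0 vN_P)).
Qed.

Lemma jones_vec_xi0 : e xi0 = xi0.
Proof. exact: (jones_fix hdot vN_P (@L2_xi0 _ _ dot P xi0 vN_P)). Qed.

Lemma jones_frakS n : e \o z n = z n \o e.
Proof. exact: (jones_commute hdot xi0 vN_P (frakS_P n)). Qed.

Lemma jones_frakS_adjoint n : e \o (z n)^* = (z n)^* \o e.
Proof. by have [m ->] := frakS_adjoint n; exact: jones_frakS. Qed.

(** On compressed operators conjugation by z_n is conjugation by z_n e, an element of P e_P, where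
    bimodularity is available. *)
Lemma corner_frakS S n : e \o S \o e = S ->
  (z n)^* \o S \o z n = ((z n)^* \o e) \o S \o (z n \o e).
Proof. by move=> eS; rewrite -jones_frakS -[in LHS]eS. Qed.

Lemma corner_idem S : e \o (e \o S \o e) \o e = e \o S \o e.
Proof.
have ee h : e (e h) = e h by rewrite -[LHS]/((e \o e) h) (jones_idem hdot _ vN_P).
by apply: cornerP => h /=; rewrite ee.
Qed.

(** As e_P commutes with the d_n, one has phi(e S e) = e phi(S) e. *)
Lemma corner_harmonic : corner e Hphi `<=` Hphi.
Proof.
move=> _ [S /harmonicP[bS hS] <-]; apply/harmonicP.
have be : bounded_op e := jones_bounded hdot xi0 vN_P.
have ed n : e \o d n = d n \o e.
  exact: (jones_mirror hdot vM dM JP vN_P P_sub (vN_adjoint vN_P (frakS_P n))).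
have beS := bounded_op_comp be bS; split; first exact: (bounded_op_comp beS be).
rewrite (column_map_mulr hdot mirrored_isometry beS be ed).
rewrite (column_map_mull hdot mirrored_isometry bS be) ?hS // => n.
by rewrite (jones_adjoint hdot xi0 vN_P).
Qed.

Lemma basic_extension_rigidity (X : set (H -> H)) (Phi : (H -> H) -> H -> H) :
  MeP `<=` X -> X `<=` Hphi -> bimodule MeP X -> (forall T, X T -> Hphi (Phi T)) ->
  linear_on X Phi -> Phi id = id -> normal_on dot X Phi -> bimodule_map MeP X Phi ->
  forall T, X T -> Phi T = T.
Proof.
move=> MX Xh [bX X0 lX mX] hPhi lPhi Phi1 nPhi mPhi T XT.
have vB := vN_basic_extension hdot vM dM JP vN_P P_sub.
have Me : MeP e := basic_extension_jones hdot vM dM JP vN_P P_sub.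
have MM := sub_basic_extension hdot vM dM JP P_sub.
have le := bounded_op_lin (vN_bounded vB Me).
have Xm x y S : MeP x -> MeP y -> X S -> X (x \o S \o y).
  by move=> Mx My XS; apply: (mX _ _ My (mX _ _ Mx XS).1).2.
have Mz n : MeP (z n) by apply: MM; exact: frakS_in.
have Mz' n : MeP ((z n)^*) := vN_adjoint vB (Mz n).
(* The vacuum argument is for compressed operators; by the bimodule property those in [X] include
   every e b^* T a e with a, b in [M]. *)
pose Y := [set S | X S /\ e \o S \o e = S].
have YX : Y `<=` X by move=> S [].
have rig : forall S, Y S -> dot (Phi S xi0) xi0 = dot (S xi0) xi0.
  apply: (@vacuum_rigidity Y Phi).
  - by move=> S [/Xh].
  - by move=> S [].
  - by split=> //; apply/funext => h /=; exact: (lin0 le).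
  - move=> b S S' [XS eS] [XS' eS']; split; first exact: lX.
    by apply/funext => h /=; rewrite !fctE le -[in RHS]eS -[in RHS]eS'.
  - move=> x Px; have [Mxe exe] := jones_corner_mul hdot vM dM JP vN_P P_sub Px.
    by split=> //; exact: MX.
  - move=> n S [XS eS]; split; first exact: Xm.
    rewrite (corner_frakS _ eS) -jones_frakS_adjoint.
    exact: (corner_idem ((z n)^* \o S \o z n)).
  - by move=> S /YX/hPhi.
  - by move=> b S S' /YX XS /YX; exact: lPhi.
  - exact: (@continuous_subspaceW (sigma_weak dot) (sigma_weak dot) Y X Phi YX nPhi).
  - by move=> n S /YX XS; exact: mPhi.
  - move=> x Px; have [Mxe _] := jones_corner_mul hdot vM dM JP vN_P P_sub Px.
    (* As x e lies in <M, e_P>, Phi(x e) = x e Phi(1) = x e. *)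
    have := mPhi (x \o e) id id Mxe (vN_id vB) (MX _ (vN_id vB)).
    by rewrite Phi1 => -> /=; rewrite jones_vec_xi0.
have bT := bX _ XT; have [bP _] := (harmonicP _).1 (hPhi _ XT).
have vec a : M a -> Phi T (a xi0) = T (a xi0).
  move=> Ma; apply: (L2_ext hdot vM (xi0 := xi0)); [by rewrite dM | by rewrite dM |].
  move=> b Mb; have bb := vN_bounded vM Mb.
  rewrite !(adjointPr hdot _ _ bb).
  (* The coefficient <T a xi0, b xi0> is the vacuum value of e b^* T a e, since e fixes xi0; both
     outer factors lie in <M, e_P>. *)
  have Mb' : MeP (e \o b^*) := vN_comp vB Me (vN_adjoint vB (MM _ Mb)).
  have Ma' : MeP (a \o e) := vN_comp vB (MM _ Ma) Me.
  have := rig ((e \o b^*) \o T \o (a \o e)).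
  rewrite mPhi //= !jones_vec_xi0.
  have es h k : dot (e h) k = dot h (e k).
    by rewrite (adjointP hdot _ _ (vN_bounded vB Me)) (jones_adjoint hdot xi0 vN_P).
  rewrite !es jones_vec_xi0 => ->//.
  split; first exact: Xm.
  exact: (corner_idem (b^* \o T \o a)).
apply/funext => h; apply: (@bounded_op_eq_closure _ _ [set x xi0 | x in M] _ _ _ bP bT).
  by move=> _ [a Ma <-]; exact: vec.
by rewrite dM.
Qed.

Lemma jones_corner_rigidity (X : set (H -> H)) (Phi : (H -> H) -> H -> H) :
  let PeP := [set x \o e | x in P] in
  PeP `<=` X -> X `<=` corner e Hphi -> bimodule PeP X -> (forall T, X T -> corner e Hphi (Phi T)) ->
  linear_on X Phi -> Phi e = e -> normal_on dot X Phi -> bimodule_map PeP X Phi ->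
  forall T, X T -> Phi T = T.
Proof.
move=> PeP MX Xh [bX X0 lX mX] hPhi lPhi Phi1 nPhi mPhi T XT.
have PPe x : P x -> PeP (x \o e) by move=> Px; exists x.
have Xe S : corner e Hphi S -> e \o S \o e = S by move=> [S' _ <-]; exact: corner_idem.
have Xm x y S : P x -> P y -> X S -> X ((x \o e) \o S \o (y \o e)).
  by move=> Px Py XS; apply: (mX _ _ (PPe _ Py) (mX _ _ (PPe _ Px) XS).1).2.
have Pz n : P (z n) := frakS_P n.
have Pz' n : P ((z n)^*) := vN_adjoint vN_P (Pz n).
have Xee : X e by apply: MX; exists id => //; exact: (vN_id vN_P).
have ee h : e (e h) = e h by rewrite -[LHS]/((e \o e) h) (jones_idem hdot _ vN_P).
have rig : forall S, X S -> dot (Phi S xi0) xi0 = dot (S xi0) xi0.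
  apply: (@vacuum_rigidity X Phi) => //.
  - by move=> S /Xh/corner_harmonic.
  - by move=> S /Xh/Xe.
  - by move=> x /PPe/MX.
  - by move=> n S XS; rewrite (corner_frakS _ (Xe _ (Xh _ XS))); exact: Xm.
  - by move=> S /hPhi/corner_harmonic.
  - move=> n S XS; rewrite (corner_frakS _ (Xe _ (Xh _ XS))) mPhi //; [|exact: PPe|exact: PPe].
    by rewrite -(corner_frakS _ (Xe _ (hPhi _ XS))).
  - move=> x Px; have Pe : PeP e by exists id => //; exact: (vN_id vN_P).
    have xe : (x \o e) \o e \o e = x \o e.
      by apply/funext => h /=; rewrite !ee.
    have := mPhi (x \o e) e e (PPe _ Px) Pe Xee; rewrite Phi1 xe => ->.
    by rewrite /= !jones_vec_xi0.
have bT := bX _ XT; have [bP _] := (harmonicP _).1 (corner_harmonic (hPhi _ XT)).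
have eT := Xe _ (Xh _ XT); have eP := Xe _ (hPhi _ XT).
(* Testing on P xi0 is enough: both operators take values in L^2(P) and vanish on its orthogonal
   complement. *)
have vec a : P a -> Phi T (a xi0) = T (a xi0).
  move=> Pa; apply: (L2_ext hdot vN_P (xi0 := xi0)); [exact: (corner_in hdot vN_P)..|].
  move=> b Pb; have bb := vN_bounded vN_P Pb; have Pb' := vN_adjoint vN_P Pb.
  rewrite !(adjointPr hdot _ _ bb).
  have := rig _ (Xm _ _ _ Pb' Pa XT); rewrite mPhi //=; [|exact: PPe|exact: PPe].
  by rewrite !jones_vec_xi0 (corner_l hdot vN_P _ eT) (corner_l hdot vN_P _ eP).
apply/funext => h; rewrite -(corner_r hdot vN_P h eT) -(corner_r hdot vN_P h eP).
apply: (@bounded_op_eq_closure _ _ [set x xi0 | x in P] _ _ _ bP bT).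
  by move=> _ [a Pa <-]; exact: vec.
exact: (jones_in hdot vN_P).
Qed.

End HarmonicOperators.

Theorem theorem3p3 (R : realType) (H : completeNormedModType (Cplx R))
    (dot : {dot H for conjC}) (M : set (H -> H))
    (tau : (H -> H) -> Cplx R) (xi0 : H) (J : H -> H) (z : nat -> H -> H) :
  hilbert dot ->
  II1_factor dot M ->
  tracial_state dot M tau ->
  trace_representation dot M tau xi0 ->
  modular_conjugation dot M xi0 J ->
  frakS dot M z ->
  let phi := Ad_sum dot J z in
  let Hphi := harmonic_operators phi in
  let P := generated_vN dot (range z) in
  let eP := jones_projection dot xi0 P in
  let PeP := [set x \o eP | x in P] in
  let MeP := basic_extension J P in
  (forall (X : set (H -> H)) (Phi : (H -> H) -> H -> H),
     MeP `<=` X -> X `<=` Hphi -> bimodule MeP X ->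
     (forall T, X T -> Hphi (Phi T)) ->
     linear_on X Phi -> Phi id = id -> normal_on dot X Phi ->
     bimodule_map MeP X Phi ->
     forall T, X T -> Phi T = T)
  /\
  (PeP = corner eP MeP /\
   forall (X : set (H -> H)) (Phi : (H -> H) -> H -> H),
     PeP `<=` X -> X `<=` corner eP Hphi -> bimodule PeP X ->
     (forall T, X T -> corner eP Hphi (Phi T)) ->
     linear_on X Phi -> Phi eP = eP -> normal_on dot X Phi ->
     bimodule_map PeP X Phi ->
     forall T, X T -> Phi T = T).

Proof.
move=> hdot [[vM _] _ _] _ [_ dM] JP zS phi Hphi P eP PeP MeP; split.
  exact: (basic_extension_rigidity hdot vM dM JP zS).
have vP := vN_P vM zS; have PM := @P_sub _ _ _ _ _ vM zS.
split; first exact: (corner_basic_extension hdot vM dM JP vP PM).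
exact: (jones_corner_rigidity hdot vM dM JP zS).
Qed.
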